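(* Let $B$ be an S-open subset of ${}^*\mathbb{C}^n$, $a\in B$ a bounded point, and $f:B\to{}^*\mathbb{C}$ an internal holomorphic function on $B$ which is bounded at every point of the halo $\mu(a)$. Then there exists an S-open neighbourhood $V$ of $a$ such that: (i) $f$ is S-continuous at every point of $V$; (ii) there is a holomorphic function ${}^\circ f:{}^\circ V\to\mathbb{C}$ such that $f(z)\approx{}^\circ f({}^\circ z)$ for the points $z\in V$ with ${}^\circ z\in{}^\circ V$, and ${}^\circ(\partial^\alpha f)=\partial^\alpha({}^\circ f)$ for every $\alpha\in\mathbb{N}^n$; (iii) if ${}^\circ f$ is not constant on ${}^\circ V$, then $f(\mu(a))=\mu(f(a))$.
   Context: ${}^*\mathbb{C}$ is the ultrapower of $\mathbb{C}$ by a nonprincipal ultrafilter $\mathcal{U}$ on $\mathbb{N}$. A point of ${}^*\mathbb{C}^n$ is bounded if its coordinates have modulus $\le r$ for some standard real $r$; bounded points $z$ have a standard part ${}^\circ z\in\mathbb{C}^n$; $x\approx y$ means $|x-y|$ is infinitesimal, and $\mu(x)=\{y: y\approx x\}$. The S-topology on ${}^*\mathbb{C}^n$ has basis the S-balls $\{q: {}^\circ|q-p|<r\}$ ($p\in{}^*\mathbb{C}^n$, $r>0$ standard real). An internal function $f=[f_i]$ on an internal set $D=[D_i]\subset{}^*\mathbb{C}^n$ is internal holomorphic if $\{i: D_i \text{ open and } f_i \text{ holomorphic on } D_i\}\in\mathcal{U}$; $\partial^\alpha f:=[\partial^\alpha f_i]$. $f$ is S-continuous at $z$ if $f(\mu(z))\subset\mu(f(z))$.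 For $V\subset{}^*\mathbb{C}^n$, ${}^\circ V=\{x\in\mathbb{C}^n:\mu(x)\cap V\neq\emptyset\}$. For a function $g$ bounded and S-continuous near a standard point $x$, ${}^\circ g(x)$ is the standard part of $g(x)$. *)

(* Defs.v *)
From Stdlib Require Import Reals ClassicalEpsilon.
From Coquelicot Require Import Coquelicot.
From mathcomp Require Import ssreflect ssrfun ssrbool eqtype ssrnat seq fintype.

Set Implicit Arguments.
Unset Strict Implicit.

Local Open Scope R_scope.
Local Open Scope C_scope.

Definition nonprincipal_ultrafilter (U : (nat -> Prop) -> Prop) : Prop :=
  U (fun _ => True) /\ ~ U (fun _ => False) /\
  (forall A B : nat -> Prop, (forall i, A i -> B i) -> U A -> U B) /\
  (forall A B : nat -> Prop, U A -> U B -> U (fun i => A i /\ B i)) /\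
  (forall A : nat -> Prop, U A \/ U (fun i => ~ A i)) /\
  (forall m : nat, ~ U (fun i => i = m)).

Definition Vec (n : nat) := 'I_n -> C.
Definition vadd n (u v : Vec n) : Vec n := fun k => u k + v k.
Definition vsub n (u v : Vec n) : Vec n := fun k => u k - v k.
Definition vscal n (c : C) (v : Vec n) : Vec n := fun k => c * v k.
Definition vnorm n (v : Vec n) : R :=
  sqrt (List.fold_right (fun k acc => (Cmod (v k) ^ 2 + acc)%R) 0%R (enum 'I_n)).
Definition vdot n (c h : Vec n) : C :=
  List.fold_right (fun k acc => c k * h k + acc) 0 (enum 'I_n).
Definition ebasis n (k : 'I_n) : Vec n := fun j => if j == k then 1 else 0.

Definition is_open_set n (D : Vec n -> Prop) : Prop :=
  forall z, D z -> exists r, (0 < r)%R /\ forall w, (vnorm (vsub w z) < r)%R -> D w.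

Definition cdiff n (g : Vec n -> C) (z : Vec n) : Prop :=
  exists c : Vec n, forall eps, (0 < eps)%R -> exists delta, (0 < delta)%R /\
    forall h : Vec n, (vnorm h < delta)%R ->
      (Cmod (g (vadd z h) - g z - vdot c h) <= eps * vnorm h)%R.

Definition holomorphic_on n (D : Vec n -> Prop) (g : Vec n -> C) : Prop :=
  is_open_set D /\ forall z, D z -> cdiff g z.

Definition is_pderiv n (g : Vec n -> C) (k : 'I_n) (z : Vec n) (l : C) : Prop :=
  forall eps, (0 < eps)%R -> exists delta, (0 < delta)%R /\
    forall h : C, h <> 0 -> (Cmod h < delta)%R ->
      (Cmod ((g (vadd z (vscal h (ebasis k))) - g z) / h - l) < eps)%R.

Definition pderiv n (k : 'I_n) (g : Vec n -> C) : Vec n -> C :=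
  fun z => epsilon (inhabits (0 : C)) (is_pderiv g k z).

Definition dalpha n (alpha : 'I_n -> nat) (g : Vec n -> C) : Vec n -> C :=
  List.fold_right (fun k acc => Nat.iter (alpha k) (pderiv k) acc) g (enum 'I_n).

Definition HC := nat -> C.               (* representatives of points of *C *)
Definition HV n := nat -> Vec n.          (* representatives of points of *C^n *)
Definition cstC (x : C) : HC := fun _ => x.
Definition cstV n (x : Vec n) : HV n := fun _ => x.

Section Ultra.
Variable U : (nat -> Prop) -> Prop.

Definition heqV n (z w : HV n) : Prop := U (fun i => z i = w i).
Definition heqC (z w : HC) : Prop := U (fun i => z i = w i).

(* a set of points of *C^n, given on representatives, must respect U-equality *)
Definition respects n (S : HV n -> Prop) : Prop :=
  forall z w, heqV z w -> S z -> S w.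

Definition boundedV n (z : HV n) : Prop :=
  exists r : R, U (fun i => forall k, (Cmod (z i k) <= r)%R).
Definition boundedC (z : HC) : Prop :=
  exists r : R, U (fun i => (Cmod (z i) <= r)%R).

Definition approxV n (z w : HV n) : Prop :=
  forall eps, (0 < eps)%R -> U (fun i => (vnorm (vsub (z i) (w i)) < eps)%R).
Definition approxC (z w : HC) : Prop :=
  forall eps, (0 < eps)%R -> U (fun i => (Cmod (z i - w i) < eps)%R).

(* S-ball {q : st|q - p| < r} *)
Definition Sball n (p : HV n) (r : R) (q : HV n) : Prop :=
  exists s : R, (s < r)%R /\ U (fun i => (vnorm (vsub (q i) (p i)) <= s)%R).

Definition Sopen n (S : HV n -> Prop) : Prop :=
  forall p, S p -> exists r : R, (0 < r)%R /\ forall q, Sball p r q -> S q.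

(* internal function f = [f_i] evaluated at z = [z_i] *)
Definition hev n (fs : nat -> Vec n -> C) (z : HV n) : HC := fun i => fs i (z i).

Definition internal_holomorphic n (Ds : nat -> Vec n -> Prop)
  (fs : nat -> Vec n -> C) : Prop :=
  U (fun i => holomorphic_on (Ds i) (fs i)).

Definition in_internal n (Ds : nat -> Vec n -> Prop) (z : HV n) : Prop :=
  U (fun i => Ds i (z i)).

Definition S_continuous_at n (fs : nat -> Vec n -> C) (z : HV n) : Prop :=
  forall w, approxV w z -> approxC (hev fs w) (hev fs z).

Definition shadow n (V : HV n -> Prop) (x : Vec n) : Prop :=
  exists z, V z /\ approxV z (cstV x).

End Ultra.

(* Main.v *)
(* By saturation, [f] is holomorphic and bounded by one standard constant on a
   standard ball around the standard part of [a]. Cauchy's estimates on that ball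
   are uniform, so they bound the first-order Taylor remainders of almost all
   [f_i] by a common quadratic term; passing to standard parts, the standard part
   [g] is holomorphic with derivatives the standard parts of those of [f].
   For surjectivity onto the halo of [f(a)], restrict to a complex line through
   the standard part of [a] on which [g] is not constant: there [g - g(x0)] is
   bounded away from zero on arbitrarily small circles, so the minimum modulus
   principle forces [f_i - w_i] to vanish inside them, and saturation puts a zero
   in the halo of [a].

   Holomorphy is mere complex differentiability, so everything rests on Goursat's
   theorem for rectangles. It is applied after the substitution [z = exp s],
   which turns concentric circles into opposite sides of a rectangle. All
   one-variable results are then consequences of [circle_bound], in which
   constants are not optimal (real and imaginary parts are integrated
   separately). *)
Require Import Defs.
From Stdlib Require Import Reals Lra Lia Classical ClassicalEpsilon FunctionalExtensionality.
From Coquelicot Require Import Coquelicot.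
From mathcomp Require Import ssreflect ssrfun ssrbool eqtype ssrnat seq fintype.

Set Implicit Arguments.
Unset Strict Implicit.

Local Open Scope R_scope.

(** No power series and no iterated integrals occur. A uniform quadratic remainder lets a pointwise
    limit along the ultrafilter inherit differentiability. The same argument, applied to difference
    quotients, makes partial derivatives holomorphic again, so all orders of derivation commute with
    standard parts by iterating one step. Isolation of zeros comes from orders of vanishing. If
    there is a last [k] with [f = o(t^k)], then [f / t^(k-1)] is differentiable at 0 with a nonzero
    second-order term; if there is none, bounds on circles force [f] to vanish near 0. On the chosen
    line, [g - g(x0)] is only known to be nonzero at parameter 1, while isolation is wanted at 0; a
    chain of discs along the segment bridges the two. *)

Lemma Cmod_le_abs (z : C) : Cmod z <= Rabs z.1 + Rabs z.2.
Proof.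
have -> : z = (RtoC z.1 + Ci * RtoC z.2)%C.
  by case: z => x y; apply: injective_projections => /=; ring.
apply: Rle_trans (Cmod_triangle _ _) _.
rewrite Cmod_mult !Cmod_R Cmod_Ci Rmult_1_l /=.
by rewrite !(Rmult_0_l, Rmult_1_l, Rmult_0_r, Rmult_1_r, Rminus_0_r, Rplus_0_l, Rplus_0_r); lra.
Qed.

Lemma abs_re_le_Cmod (z : C) : Rabs z.1 <= Cmod z.
Proof. exact: Rle_trans (Rmax_l _ _) (Rmax_Cmod z). Qed.

Lemma abs_im_le_Cmod (z : C) : Rabs z.2 <= Cmod z.
Proof. exact: Rle_trans (Rmax_r _ _) (Rmax_Cmod z). Qed.

Lemma Csub_eq0 (x y : C) : (x - y = 0)%C -> x = y.
Proof.
move=> E; have -> : x = (x - y + y)%C by ring.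
by rewrite E; ring.
Qed.

Lemma Cmod_sub_sym (x y : C) : Cmod (x - y) = Cmod (y - x).
Proof. by rewrite -Cmod_opp; congr Cmod; ring. Qed.

(** * Complex differentiability *)

Definition ccont (f : C -> C) (z : C) : Prop :=
  forall eps, 0 < eps -> exists delta, 0 < delta /\
    forall w, Cmod (w - z) < delta -> Cmod (f w - f z) < eps.

Definition cder (f : C -> C) (z l : C) : Prop :=
  forall eps, 0 < eps -> exists delta, 0 < delta /\
    forall h, Cmod h < delta -> Cmod (f (z + h) - f z - l * h)%C <= eps * Cmod h.

(** Gives access to Coquelicot's rules for sums, products and composites. *)
Lemma ccont_continuous (f : C -> C) (z : C) :
  ccont f z <-> @continuous (AbsRing_UniformSpace C_AbsRing)
                  (AbsRing_UniformSpace C_AbsRing) f z.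
Proof.
split=> [H | /filterlim_locally H].
  apply/filterlim_locally => eps.
  have [d [d0 Hd]] := H eps (cond_pos eps).
  by exists (mkposreal d d0) => w Hw; apply: Hd.
move=> eps e0; have [d Hd] := H (mkposreal eps e0).
by exists d; split; [exact: cond_pos | move=> w Hw; apply: Hd].
Qed.

Lemma ccont_const (c z : C) : ccont (fun _ => c) z.
Proof. by apply/ccont_continuous; exact: continuous_const. Qed.

Lemma ccont_id (z : C) : ccont (fun w => w) z.
Proof. by apply/ccont_continuous; exact: continuous_id. Qed.

Lemma ccont_plus (f g : C -> C) (z : C) :
  ccont f z -> ccont g z -> ccont (fun w => f w + g w)%C z.
Proof.
move=> /ccont_continuous Hf /ccont_continuous Hg; apply/ccont_continuous.
exact: (@continuous_plus (AbsRing_UniformSpace C_AbsRing) C_AbsRing (AbsRing_NormedModule C_AbsRing) f g).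
Qed.

Lemma ccont_mult (f g : C -> C) (z : C) :
  ccont f z -> ccont g z -> ccont (fun w => f w * g w)%C z.
Proof.
move=> /ccont_continuous Hf /ccont_continuous Hg; apply/ccont_continuous.
exact: (@continuous_mult (AbsRing_UniformSpace C_AbsRing) C_AbsRing f g).
Qed.

Lemma ccont_comp (f g : C -> C) (z : C) :
  ccont g z -> ccont f (g z) -> ccont (fun w => f (g w)) z.
Proof.
move=> /ccont_continuous Hg /ccont_continuous Hf; apply/ccont_continuous.
exact: (@continuous_comp (AbsRing_UniformSpace C_AbsRing)
  (AbsRing_UniformSpace C_AbsRing) (AbsRing_UniformSpace C_AbsRing) g f z).
Qed.

(* Caratheodory's form of differentiability: the rules of calculus reduce to
   continuity of the slope function [q]. *)
Lemma cder_slope (f : C -> C) (z l : C) :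
  cder f z l <-> exists q, ccont q z /\ q z = l /\
                   forall w, f w = (f z + q w * (w - z))%C.
Proof.
split.
  move=> H; exists (fun w => if excluded_middle_informative (w = z) then l
                       else ((f w - f z) / (w - z))%C); split; [|split].
  - move=> eps e0; have [d [d0 Hd]] := H (eps / 2) ltac:(lra).
    exists d; split=> // w Hw.
    case: (excluded_middle_informative (z = z)) => // zz.
    case: (excluded_middle_informative (w = z)) => [wz|wz] /=.
      have -> : (l - l = (RtoC 0))%C by ring.
      by rewrite Cmod_0.
    have wz' : (w - z)%C <> 0%C.
      by move=> /Csub_eq0.
    have m0 : 0 < Cmod (w - z) by apply/Cmod_gt_0.
    have := Hd _ Hw; have -> : (z + (w - z) = w)%C by ring.
    move=> Hw'.
    have -> : ((f w - f z) / (w - z) - l = (f w - f z - l * (w - z)) / (w - z))%C by field.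
    rewrite (Cmod_div _ _ wz').
    apply: (Rle_lt_trans _ (eps / 2)); last lra.
    exact/(Rle_div_l _ _ _ m0).
  - by case: excluded_middle_informative.
  - move=> w; case: excluded_middle_informative => [wz|wz] /=; first by rewrite wz; ring.
    by field => /Csub_eq0.
case=> q [Hq [<- Hf]] eps e0.
have [d [d0 Hd]] := Hq eps e0.
exists d; split=> // h Hh.
rewrite (Hf (z + h)%C).
have -> : (f z + q (z + h) * (z + h - z) - f z - q z * h = ((q (z + h) - q z) * h)%C)%C by ring.
rewrite Cmod_mult; apply: Rmult_le_compat_r; first exact: Cmod_ge_0.
apply: Rlt_le; apply: Hd; by have -> : (z + h - z = h)%C by ring.
Qed.

Lemma cder_ext (f g : C -> C) (z l : C) (r : R) : 0 < r ->
  (forall w, Cmod (w - z) < r -> f w = g w) -> cder f z l -> cder g z l.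
Proof.
move=> r0 E H eps e0; have [d [d0 Hd]] := H eps e0.
exists (Rmin d r); split; first exact: Rmin_pos.
move=> h Hh; rewrite -!E.
- by apply: Hd; apply: Rlt_le_trans Hh (Rmin_l _ _).
- have -> : (z - z = RtoC 0)%C by ring.
  by rewrite Cmod_0.
- have -> : (z + h - z = h)%C by ring.
  exact: Rlt_le_trans Hh (Rmin_r _ _).
Qed.

Lemma cder_const (c z : C) : cder (fun _ => c) z 0%C.
Proof. by apply/cder_slope; exists (fun _ => 0%C); split; [exact: ccont_const | split=> // w; ring]. Qed.

Lemma cder_id (z : C) : cder (fun w => w) z 1%C.
Proof. by apply/cder_slope; exists (fun _ => 1%C); split; [exact: ccont_const | split=> // w; ring]. Qed.

Lemma cder_cont (f : C -> C) (z l : C) : cder f z l -> ccont f z.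
Proof.
move=> /cder_slope [q [Hq [_ E]]].
have -> : f = (fun w => f z + q w * (w + (- z)))%C.
  by apply: functional_extensionality => w; rewrite {1}(E w); ring.
apply: ccont_plus; first exact: ccont_const.
apply: ccont_mult => //; apply: ccont_plus; [exact: ccont_id | exact: ccont_const].
Qed.

Lemma cder_plus (f g : C -> C) (z l m : C) :
  cder f z l -> cder g z m -> cder (fun w => f w + g w)%C z (l + m)%C.
Proof.
move=> /cder_slope [q [Hq [<- E]]] /cder_slope [p [Hp [<- F]]].
apply/cder_slope; exists (fun w => q w + p w)%C; split; first exact: ccont_plus.
by split=> // w; rewrite {1}(E w) {1}(F w); ring.
Qed.

Lemma cder_mult (f g : C -> C) (z l m : C) :
  cder f z l -> cder g z m -> cder (fun w => f w * g w)%C z (l * g z + f z * m)%C.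
Proof.
move=> Hf' Hg'; have Cg := cder_cont Hg'.
move: Hf' Hg' => /cder_slope [q [Hq [<- E]]] /cder_slope [p [Hp [<- F]]].
apply/cder_slope; exists (fun w => q w * g w + f z * p w)%C; split.
  by apply: ccont_plus; apply: ccont_mult => //; exact: ccont_const.
split=> // w.
have -> : ((q w * g w + f z * p w) * (w - z) = ((q w * (w - z)) * g w + f z * (p w * (w - z)))%C)%C by ring.
have -> : (p w * (w - z) = g w - g z)%C by rewrite (F w); ring.
have -> : (q w * (w - z) = f w - f z)%C by rewrite (E w); ring.
ring.
Qed.

Lemma cder_comp (f g : C -> C) (z l m : C) :
  cder g z l -> cder f (g z) m -> cder (fun w => f (g w)) z (m * l)%C.
Proof.
move=> Hg' Hf'; have Cg := cder_cont Hg'.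
move: Hf' Hg' => /cder_slope [q [Hq [<- E]]] /cder_slope [p [Hp [<- F]]].
apply/cder_slope; exists (fun w => q (g w) * p w)%C; split.
  by apply: ccont_mult => //; apply: ccont_comp.
by split=> // w; rewrite {1}(E (g w)) {2}(F w); ring.
Qed.

Lemma cder_inv (z : C) : z <> 0%C -> cder Cinv z (- (/ z * / z))%C.
Proof.
move=> z0 eps e0; have m0 : 0 < Cmod z by apply/Cmod_gt_0.
have m3 := Rmult_lt_0_compat _ _ e0 (pow_lt _ 3 m0).
(* The remainder is [h^2 / (z^2 (z + h))], and the first bound on [h] gives [|z + h| > |z| / 2];
   hence the cube and the factor 1/2 in the second. *)
exists (Rmin (Cmod z / 2) (eps * Cmod z ^ 3 / 2)); split.
  by apply: Rmin_pos; lra.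
move=> h Hh.
have Hh1 := Rlt_le_trans _ _ _ Hh (Rmin_l _ _).
have Hh2 := Rlt_le_trans _ _ _ Hh (Rmin_r _ _).
have mw : Cmod z / 2 < Cmod (z + h).
  have := Cmod_triangle (z + h) (- h).
  have -> : (z + h + - h = z)%C by ring.
  by rewrite Cmod_opp; lra.
have w0 : (z + h)%C <> 0%C by apply/Cmod_gt_0; lra.
have -> : (/ (z + h) - / z - - (/ z * / z) * h = (h / (z * z * (z + h)) * h)%C)%C by field.
rewrite Cmod_mult; apply: Rmult_le_compat_r; first exact: Cmod_ge_0.
rewrite Cmod_div; last by do ! apply: Cmult_neq_0.
rewrite !Cmod_mult.
have mm := Rmult_lt_0_compat _ _ m0 m0.
have mwz : Cmod z ^ 3 / 2 < Cmod z * Cmod z * Cmod (z + h) by nra.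
have := Rmult_lt_compat_l _ _ _ e0 mwz => H.
by apply/Rle_div_l; [nra | lra].
Qed.

(** * Cauchy's theorem for rectangles *)

Definition cint (p : R -> C) (a b : R) : C :=
  (RInt (fun t => (p t).1) a b, RInt (fun t => (p t).2) a b).

Definition pcont (p : R -> C) (a b : R) : Prop :=
  forall t, a <= t <= b -> forall eps, 0 < eps -> exists delta, 0 < delta /\
    forall s, Rabs (s - t) < delta -> Cmod (p s - p t) < eps.

Lemma pcont_re (p : R -> C) (a b : R) : pcont p a b ->
  forall t, a <= t <= b -> continuous (fun t => (p t).1) t.
Proof.
move=> H t Ht; apply/filterlim_locally => eps.
have [d [d0 Hd]] := H t Ht eps (cond_pos eps).
exists (mkposreal d d0) => s Hs.
exact: Rle_lt_trans (abs_re_le_Cmod (p s - p t)) (Hd s Hs).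
Qed.

Lemma pcont_im (p : R -> C) (a b : R) : pcont p a b ->
  forall t, a <= t <= b -> continuous (fun t => (p t).2) t.
Proof.
move=> H t Ht; apply/filterlim_locally => eps.
have [d [d0 Hd]] := H t Ht eps (cond_pos eps).
exists (mkposreal d d0) => s Hs.
exact: Rle_lt_trans (abs_im_le_Cmod (p s - p t)) (Hd s Hs).
Qed.

Lemma pcont_ex_RInt (p : R -> C) (a b : R) : a <= b -> pcont p a b ->
  ex_RInt (fun t => (p t).1) a b /\ ex_RInt (fun t => (p t).2) a b.
Proof.
move=> ab H; split; apply: (@ex_RInt_continuous R_CompleteNormedModule) => t;
  rewrite Rmin_left // Rmax_right // => Ht.
- exact: pcont_re H t Ht.
- exact: pcont_im H t Ht.
Qed.

Lemma pcont_sub (p : R -> C) (a b c d : R) : a <= c -> d <= b ->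
  pcont p a b -> pcont p c d.
Proof. by move=> ac db H t Ht; apply: H; lra. Qed.

Lemma pcont_minus (p q : R -> C) (a b : R) : pcont p a b -> pcont q a b ->
  pcont (fun t => p t - q t)%C a b.
Proof.
move=> Hp Hq t Ht eps e0.
have [d [d0 Hd]] := Hp t Ht (eps / 2) ltac:(lra).
have [e [f0 He]] := Hq t Ht (eps / 2) ltac:(lra).
exists (Rmin d e); split; first exact: Rmin_pos.
move=> s Hs.
have := Hd s (Rlt_le_trans _ _ _ Hs (Rmin_l _ _)).
have := He s (Rlt_le_trans _ _ _ Hs (Rmin_r _ _)).
have -> : (p s - q s - (p t - q t) = (p s - p t) + - (q s - q t))%C by ring.
have := Cmod_triangle (p s - p t) (- (q s - q t)).
rewrite Cmod_opp; lra.
Qed.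

Lemma pcont_const (c : C) (a b : R) : pcont (fun _ => c) a b.
Proof.
move=> t Ht eps e0; exists 1; split; first lra.
move=> s _; have -> : (c - c = RtoC 0)%C by ring.
by rewrite Cmod_0.
Qed.

Lemma cint_minus (p q : R -> C) (a b : R) : a <= b -> pcont p a b -> pcont q a b ->
  cint (fun t => p t - q t)%C a b = (cint p a b - cint q a b)%C.
Proof.
move=> ab /(pcont_ex_RInt ab) [p1 p2] /(pcont_ex_RInt ab) [q1 q2].
by apply: injective_projections => /=;
  [exact: (RInt_minus _ _ _ _ p1 q1) | exact: (RInt_minus _ _ _ _ p2 q2)].
Qed.

Lemma cint_const (c : C) (a b : R) : cint (fun _ => c) a b = (c * RtoC (b - a))%C.
Proof.
by apply: injective_projections => /=; rewrite RInt_const /scal /= /mult /=; ring.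
Qed.

Lemma cint_chasles (p : R -> C) (a m b : R) : a <= m <= b -> pcont p a b ->
  (cint p a m + cint p m b)%C = cint p a b.
Proof.
move=> [am mb] H.
have [p1 p2] := pcont_ex_RInt am (pcont_sub (Rle_refl _) mb H).
have [q1 q2] := pcont_ex_RInt mb (pcont_sub am (Rle_refl _) H).
by apply: injective_projections => /=;
  [exact: (RInt_Chasles _ _ _ _ p1 q1) | exact: (RInt_Chasles _ _ _ _ p2 q2)].
Qed.

Lemma cint_bound (p : R -> C) (a b K : R) : a <= b -> pcont p a b ->
  (forall t, a <= t <= b -> Cmod (p t) <= K) -> Cmod (cint p a b) <= 2 * K * (b - a).
Proof.
move=> ab /(pcont_ex_RInt ab) [p1 p2] HK.
apply: Rle_trans (Cmod_le_abs _) _ => /=.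
have -> : 2 * K * (b - a) = (b - a) * K + (b - a) * K by ring.
apply: Rplus_le_compat.
- apply: (norm_RInt_le_const _ _ _ _ _ ab _ (RInt_correct _ _ _ p1)) => t Ht.
  exact: Rle_trans (abs_re_le_Cmod _) (HK t Ht).
- apply: (norm_RInt_le_const _ _ _ _ _ ab _ (RInt_correct _ _ _ p2)) => t Ht.
  exact: Rle_trans (abs_im_le_Cmod _) (HK t Ht).
Qed.

(** The counterclockwise contour integral of [g(z) dz] around the rectangle: bottom minus top, plus
    [Ci] times right minus left. *)
Definition bdry (g : C -> C) (a b c d : R) : C :=
  (cint (fun x => g (x, c)) a b - cint (fun x => g (x, d)) a b +
   Ci * (cint (fun y => g (b, y)) c d - cint (fun y => g (a, y)) c d))%C.

Definition cont_rect (g : C -> C) (a b c d : R) : Prop :=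
  forall x y, a <= x <= b -> c <= y <= d -> ccont g (x, y).

Lemma cont_rect_h (g : C -> C) (a b c d y : R) : cont_rect g a b c d -> c <= y <= d ->
  pcont (fun x => g (x, y)) a b.
Proof.
move=> H Hy x Hx eps e0; have [r [r0 Hr]] := H x y Hx Hy eps e0.
exists r; split=> // s Hs; apply: Hr.
have -> : ((s, y) - (x, y) = RtoC (s - x))%C.
  by apply: injective_projections => /=; ring.
by rewrite Cmod_R.
Qed.

Lemma cont_rect_v (g : C -> C) (a b c d x : R) : cont_rect g a b c d -> a <= x <= b ->
  pcont (fun y => g (x, y)) c d.
Proof.
move=> H Hx y Hy eps e0; have [r [r0 Hr]] := H x y Hx Hy eps e0.
exists r; split=> // s Hs; apply: Hr.
have -> : ((x, s) - (x, y) = Ci * RtoC (s - y))%C.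
  by apply: injective_projections => /=; ring.
by rewrite Cmod_mult Cmod_Ci Cmod_R Rmult_1_l.
Qed.

Lemma bdry_split_h (g : C -> C) (a m b c d : R) : a <= m <= b -> c <= d ->
  cont_rect g a b c d -> bdry g a b c d = (bdry g a m c d + bdry g m b c d)%C.
Proof.
move=> Hm cd H; rewrite /bdry.
rewrite -(cint_chasles Hm (cont_rect_h H (conj (Rle_refl c) cd))).
rewrite -(cint_chasles Hm (cont_rect_h H (conj cd (Rle_refl d)))).
ring.
Qed.

Lemma bdry_split_v (g : C -> C) (a b c m d : R) : a <= b -> c <= m <= d ->
  cont_rect g a b c d -> bdry g a b c d = (bdry g a b c m + bdry g a b m d)%C.
Proof.
move=> ab Hm H; rewrite /bdry.
rewrite -(cint_chasles Hm (cont_rect_v H (conj (Rle_refl a) ab))).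
rewrite -(cint_chasles Hm (cont_rect_v H (conj ab (Rle_refl b)))).
ring.
Qed.

Lemma cont_rect_sub (g : C -> C) (a b c d a' b' c' d' : R) :
  a <= a' -> b' <= b -> c <= c' -> d' <= d ->
  cont_rect g a b c d -> cont_rect g a' b' c' d'.
Proof. by move=> ? ? ? ? H x y ? ?; apply: H; lra. Qed.

(* A complex-affine function has zero boundary integral, so only the error of
   the linear approximation at [p] contributes. *)
Lemma bdry_local (g : C -> C) (p l : C) (a b c d eps : R) :
  a <= p.1 <= b -> c <= p.2 <= d -> cont_rect g a b c d -> 0 <= eps ->
  (forall x y, a <= x <= b -> c <= y <= d ->
     Cmod (g (x, y) - g p - l * ((x, y) - p)) <= eps * Cmod ((x, y) - p)) ->
  Cmod (bdry g a b c d) <= 4 * eps * (b - a + (d - c)) ^ 2.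
Proof.
move=> Hp1 Hp2 H e0 Hl.
have ab : a <= b by lra.
have cd : c <= d by lra.
have E x y : a <= x <= b -> c <= y <= d ->
    Cmod (g (x, y) - g p - l * ((x, y) - p)) <= eps * (b - a + (d - c)).
  move=> Hx Hy; apply: Rle_trans (Hl _ _ Hx Hy) _.
  apply: Rmult_le_compat_l => //; apply: Rle_trans (Cmod_le_abs _) _ => /=.
  by apply: Rplus_le_compat; apply: Rabs_le; lra.
have D x y x' y' k : a <= x <= b -> c <= y <= d -> a <= x' <= b -> c <= y' <= d ->
    k = (l * ((x, y) - (x', y')))%C ->
    Cmod (g (x, y) - g (x', y') - k) <= 2 * (eps * (b - a + (d - c))).
  move=> Hx Hy Hx' Hy' ->.
  have -> : (g (x, y) - g (x', y') - l * ((x, y) - (x', y')) =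
     (g (x, y) - g p - l * ((x, y) - p)) + - (g (x', y') - g p - l * ((x', y') - p)))%C by ring.
  apply: Rle_trans (Cmod_triangle _ _) _; rewrite Cmod_opp.
  have := E _ _ Hx Hy; have := E _ _ Hx' Hy'; lra.
rewrite /bdry.
have hc := cont_rect_h H (conj (Rle_refl c) cd).
have hd := cont_rect_h H (conj cd (Rle_refl d)).
have va := cont_rect_v H (conj (Rle_refl a) ab).
have vb := cont_rect_v H (conj ab (Rle_refl b)).
rewrite -(cint_minus ab hc hd) -(cint_minus cd vb va).
have hcd := pcont_minus hc hd; have vba := pcont_minus vb va.
(* The differences of the linear part between opposite sides are the constants [k1] and [k2]; their
   integrals cancel in the boundary sum. *)
pose k1 : C := (l * (0%R, (c - d)%R))%C; pose k2 : C := (l * ((b - a)%R, 0%R))%C.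
have I1 := cint_minus ab hcd (pcont_const k1 (a := a) (b := b)).
have I2 := cint_minus cd vba (pcont_const k2 (a := c) (b := d)).
rewrite !cint_const in I1 I2.
have {}I1 : cint (fun t => g (t, c) - g (t, d))%C a b =
  (cint (fun t => g (t, c) - g (t, d) - k1) a b + k1 * RtoC (b - a))%C by rewrite I1; ring.
have {}I2 : cint (fun t => g (b, t) - g (a, t))%C c d =
  (cint (fun t => g (b, t) - g (a, t) - k2) c d + k2 * RtoC (d - c))%C by rewrite I2; ring.
rewrite I1 I2.
set J1 := cint _ a b; set J2 := cint _ c d.
have -> : (J1 + k1 * RtoC (b - a) + Ci * (J2 + k2 * RtoC (d - c)) = J1 + Ci * J2)%C.
  by apply: injective_projections => /=; ring.
apply: Rle_trans (Cmod_triangle _ _) _; rewrite Cmod_mult Cmod_Ci Rmult_1_l.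
have B1 : Cmod J1 <= 2 * (2 * (eps * (b - a + (d - c)))) * (b - a).
  apply: cint_bound => //; first by apply: pcont_minus => //; exact: pcont_const.
  move=> t Ht; apply: D => //; try lra.
  by rewrite /k1 /k2; congr (l * _)%C; apply: injective_projections => /=; ring.
have B2 : Cmod J2 <= 2 * (2 * (eps * (b - a + (d - c)))) * (d - c).
  apply: cint_bound => //; first by apply: pcont_minus => //; exact: pcont_const.
  move=> t Ht; apply: D => //; try lra.
  by rewrite /k1 /k2; congr (l * _)%C; apply: injective_projections => /=; ring.
have -> : 4 * eps * (b - a + (d - c)) ^ 2 =
  2 * (2 * (eps * (b - a + (d - c)))) * (b - a) +
  2 * (2 * (eps * (b - a + (d - c)))) * (d - c) by ring.
lra.
Qed.

(** * Nested bisection of rectangles *)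

Lemma div_pow2_half (v : R) (k : nat) : v / 2 ^ k = 2 * (v / 2 ^ (S k)).
Proof. by rewrite /=; field; apply: pow_nonzero; lra. Qed.

Lemma div_pow2_ge0 (v : R) (k : nat) : 0 <= v -> 0 <= v / 2 ^ k.
Proof.
move=> v0; apply: Rmult_le_pos => //.
by apply: Rlt_le; apply: Rinv_0_lt_compat; apply: pow_lt; lra.
Qed.

(** Left ends increase and right ends decrease, so the supremum of the left ends lies in every
    interval. *)
Lemma bisection_limit (u : nat -> R) (w : R) : 0 <= w ->
  (forall k, u (S k) = u k \/ u (S k) = u k + w / 2 ^ (S k)) ->
  exists x, forall k, u k <= x <= u k + w / 2 ^ k.
Proof.
move=> w0 Hu.
have H2 := div_pow2_half w.
have W k := @div_pow2_ge0 w k w0.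
have N k : u k <= u (S k) /\ u (S k) + w / 2 ^ (S k) <= u k + w / 2 ^ k.
  by have := W (S k); rewrite (H2 k); case: (Hu k) => ->; lra.
have M k m : u k <= u (k + m)%coq_nat /\ u (k + m)%coq_nat + w / 2 ^ (k + m)%coq_nat <= u k + w / 2 ^ k.
  elim: m => [|m IH]; first by rewrite -plus_n_O; lra.
  by rewrite -plus_n_Sm; have := N (k + m)%coq_nat; lra.
have ub k m : u m <= u k + w / 2 ^ k.
  case: (Nat.le_ge_cases k m) => km.
    have [e He] : exists e, m = (k + e)%coq_nat by exists (m - k)%coq_nat; lia.
    by rewrite He; have := M k e; have := W (k + e)%coq_nat; lra.
  have [e He] : exists e, k = (m + e)%coq_nat by exists (k - m)%coq_nat; lia.
  by rewrite He; have := M m e; have := W (m + e)%coq_nat; lra.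
have [x [x1 x2]] : {x | is_lub (fun y => exists k, y = u k) x}.
  apply: completeness; last by exists (u O), O.
  by exists (u O + w / 2 ^ O) => y [k ->].
exists x => k; split; first by apply: x1; exists k.
by apply: x2 => y [m ->].
Qed.

(** [P x y k] speaks of the rectangle of generation [k] with lower left corner [(x, y)]. Were [P]
    false at the start, some quarter would be bad at every generation, and the common point of these
    nested quarters would contradict the local hypothesis. *)
Lemma bisection (P : R -> R -> nat -> Prop) (x0 y0 w h : R)
  (inside := fun x y k => x0 <= x /\ x + w / 2 ^ k <= x0 + w /\
                          y0 <= y /\ y + h / 2 ^ k <= y0 + h) :
  0 <= w -> 0 <= h ->
  (forall x y k, inside x y k ->
    P x y (S k) -> P (x + w / 2 ^ (S k)) y (S k) ->
    P x (y + h / 2 ^ (S k)) (S k) -> P (x + w / 2 ^ (S k)) (y + h / 2 ^ (S k)) (S k) ->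
    P x y k) ->
  (forall p q, x0 <= p <= x0 + w -> y0 <= q <= y0 + h ->
    exists N, forall x y, inside x y N -> x <= p <= x + w / 2 ^ N ->
      y <= q <= y + h / 2 ^ N -> P x y N) ->
  P x0 y0 O.
Proof.
move=> w0 h0 step local.
apply: NNPP => bad0.
have half := div_pow2_half; have pos := div_pow2_ge0.
pose bad k (z : R * R) := inside z.1 z.2 k /\ ~ P z.1 z.2 k.
pose child k (z z' : R * R) := (z'.1 = z.1 \/ z'.1 = z.1 + w / 2 ^ (S k)) /\
   (z'.2 = z.2 \/ z'.2 = z.2 + h / 2 ^ (S k)).
have next k z : bad k z -> exists z', child k z z' /\ bad (S k) z'.
  case: z => x y [Hin HP]; apply: NNPP => no.
  have [i1 [i2 [i3 i4]]] := Hin; move: i1 i2 i3 i4 => /= i1 i2 i3 i4.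
  have pw := pos w (S k) w0; have ph := pos h (S k) h0.
  rewrite (half w k) in i2; rewrite (half h k) in i4.
  have all x' y' : child k (x, y) (x', y') -> P x' y' (S k).
    move=> Hc; apply: NNPP => nP; apply: no; exists (x', y'); split=> //; split=> //.
    by case: Hc; rewrite /inside; cbn [fst snd] => -[] -> [] ->; lra.
  by apply: HP; apply: step => //; apply: all; split; cbn [fst snd]; auto.
pose nx k z := epsilon (inhabits z) (fun z' => child k z z' /\ bad (S k) z').
pose zs := fix zs k := match k with O => (x0, y0) | S k => nx k (zs k) end.
have Hzs k : bad k (zs k).
  elim: k => [|k IH].
    by split=> //; rewrite /inside /= !Rdiv_1_r; lra.
  by have := epsilon_spec (inhabits (zs k)) _ (next k _ IH); case.
have Hch k : child k (zs k) (zs (S k)).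
  by have := epsilon_spec (inhabits (zs k)) _ (next k _ (Hzs k)); case.
have [p Hp] := bisection_limit w0 (fun k => proj1 (Hch k)).
have [q Hq] := bisection_limit h0 (fun k => proj2 (Hch k)).
have := Hp O; have := Hq O; rewrite /= !Rdiv_1_r => Hq0 Hp0.
have [N HN] := local _ _ Hp0 Hq0.
by have [Hin nP] := Hzs N; apply: nP; apply: HN.
Qed.
(** Differentiability at a point gives a quadratic bound on small rectangles around it, by
    [bdry_local]. Four quarters with this bound give it for their union, so bisection carries it to
    the whole rectangle, where it says that the modulus is at most half of itself. *)
Lemma goursat (g : C -> C) (a b c d : R) : a <= b -> c <= d ->
  (forall x y, a <= x <= b -> c <= y <= d -> exists l, cder g (x, y) l) ->
  bdry g a b c d = 0%C.
Proof.
move=> ab cd Hg; apply: NNPP => nz.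
have I0 : 0 < Cmod (bdry g a b c d) by apply/Cmod_gt_0.
have H : cont_rect g a b c d.
  by move=> x y Hx Hy; have [l Hl] := Hg x y Hx Hy; exact: cder_cont Hl.
(* The [+ 1] keeps [s] positive when the rectangle is degenerate. The 8 in [eps] makes
   [4 * eps * s ^ 2] half of the modulus. *)
pose s := b - a + (d - c) + 1.
have s0 : 0 < s by rewrite /s; lra.
pose eps := Cmod (bdry g a b c d) / (8 * s ^ 2).
have s2 : 0 < s ^ 2 by apply: pow_lt.
have e0 : 0 < eps by apply: Rdiv_lt_0_compat; lra.
have half := div_pow2_half; have pos := div_pow2_ge0.
pose P x y k := Cmod (bdry g x (x + (b - a) / 2 ^ k) y (y + (d - c) / 2 ^ k)) <=
                4 * eps * (s / 2 ^ k) ^ 2.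
have : P a c O.
  apply: (@bisection P a c (b - a) (d - c)); [lra | lra | |].
  - move=> x y k [i1 [i2 [i3 i4]]]; rewrite /P.
    have pw := pos (b - a) (S k) ltac:(lra); have ph := pos (d - c) (S k) ltac:(lra).
    move: i2 i4.
    rewrite (half (b - a) k) (half (d - c) k) (half s k).
    move: pw ph; set u := _ / 2 ^ (S k); set v := _ / 2 ^ (S k); set t := _ / 2 ^ (S k).
    move=> pw ph i2 i4 A1 A2 A3 A4.
    have -> : 2 * u = u + u by ring.
    have -> : 2 * v = v + v by ring.
    have Hr : cont_rect g x (x + (u + u)) y (y + (v + v)) by apply: cont_rect_sub H; lra.
    rewrite (@bdry_split_h g x (x + u)) //; try lra.
    rewrite (@bdry_split_v g x (x + u) y (y + v)) //; try lra; last by apply: cont_rect_sub Hr; lra.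
    rewrite (@bdry_split_v g (x + u) _ y (y + v)) //; try lra; last by apply: cont_rect_sub Hr; lra.
    rewrite -!Rplus_assoc.
    apply: Rle_trans (Cmod_triangle _ _) _.
    have T1 := Cmod_triangle (bdry g x (x + u) y (y + v)) (bdry g x (x + u) (y + v) (y + v + v)).
    have T2 := Cmod_triangle (bdry g (x + u) (x + u + u) y (y + v)) (bdry g (x + u) (x + u + u) (y + v) (y + v + v)).
    have -> : 4 * eps * (2 * t) ^ 2 = 4 * (4 * eps * t ^ 2) by ring.
    lra.
  - move=> p q Hp Hq.
    have [l Hl] := Hg p q ltac:(lra) ltac:(lra).
    have [del [del0 Hdel]] := Hl eps e0.
    have [N HN] : exists N, s / 2 ^ N < del.
      have [N HN] := pow_lt_1_zero (/ 2) ltac:(rewrite Rabs_pos_eq; lra) (del / s) ltac:(exact: Rdiv_lt_0_compat).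
      exists N; have := HN N (Nat.le_refl _); rewrite Rabs_pos_eq; last by apply: pow_le; lra.
      by rewrite pow_inv => /(Rmult_lt_compat_l s _ _ s0); rewrite /Rdiv (Rmult_comm del) -Rmult_assoc Rinv_r ?Rmult_1_l; lra.
    exists N => x y [i1 [i2 [i3 i4]]] Hx Hy.
    have pw := pos (b - a) N ltac:(lra); have ph := pos (d - c) N ltac:(lra).
    have P1 := pos 1 N ltac:(lra).
    have ss : s / 2 ^ N = (b - a) / 2 ^ N + (d - c) / 2 ^ N + 1 / 2 ^ N by rewrite /s; lra.
    rewrite /P.
    apply: (Rle_trans _ (4 * eps * (x + (b - a) / 2 ^ N - x + (y + (d - c) / 2 ^ N - y)) ^ 2)).
      apply: (@bdry_local g (p, q) l) => //; [by apply: cont_rect_sub H; lra | lra |].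
      move=> x' y' Hx' Hy'.
      have := Hdel ((x', y') - (p, q))%C.
      have -> : ((p, q) + ((x', y') - (p, q)) = (x', y'))%C by ring.
      apply; apply: Rle_lt_trans (Cmod_le_abs _) _ => /=.
      have : Rabs (x' + - p) <= (b - a) / 2 ^ N by apply: Rabs_le; lra.
      have : Rabs (y' + - q) <= (d - c) / 2 ^ N by apply: Rabs_le; lra.
      lra.
    apply: Rmult_le_compat_l; first lra.
    apply: pow_incr; lra.
rewrite /P /= !Rdiv_1_r.
have -> : a + (b - a) = b by ring.
have -> : c + (d - c) = d by ring.
have -> : 4 * eps * (s * (s * 1)) = Cmod (bdry g a b c d) / 2 by rewrite /eps; field; lra.
lra.
Qed.

(** * Circles and Cauchy's estimates *)

Definition cexp (z : C) : C := (exp z.1 * cos z.2, exp z.1 * sin z.2).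

Lemma cexp_plus (z w : C) : cexp (z + w) = (cexp z * cexp w)%C.
Proof.
apply: injective_projections => /=; rewrite exp_plus ?cos_plus ?sin_plus; ring.
Qed.

Lemma Cmod_cexp (z : C) : Cmod (cexp z) = exp z.1.
Proof.
rewrite /Cmod /cexp [fst _]/= [snd _]/=.
have -> : (exp z.1 * cos z.2) ^ 2 + (exp z.1 * sin z.2) ^ 2 = exp z.1 ^ 2.
  have := sin2_cos2 z.2; rewrite /Rsqr => E.
  have -> : exp z.1 ^ 2 = exp z.1 ^ 2 * (sin z.2 * sin z.2 + cos z.2 * cos z.2) by rewrite E; ring.
  ring.
by rewrite sqrt_pow2 //; apply: Rlt_le; exact: exp_pos.
Qed.

Lemma derivable_pt_lim_0_bound (f : R -> R) (l eps : R) : 0 < eps ->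
  derivable_pt_lim f 0 l -> exists delta, 0 < delta /\
  forall x, Rabs x < delta -> Rabs (f x - f 0 - l * x) <= eps * Rabs x.
Proof.
move=> e0 H; have [d Hd] := H eps e0.
exists d; split; first exact: cond_pos.
move=> x Hx; case: (Req_dec x 0) => [->|x0].
  have -> : f 0 - f 0 - l * 0 = 0 by ring.
  by rewrite Rabs_R0; lra.
have := Hd x x0 Hx; rewrite Rplus_0_l => /Rlt_le H1.
have -> : f x - f 0 - l * x = ((f x - f 0) / x - l) * x by field.
by rewrite Rabs_mult; apply: Rmult_le_compat_r => //; exact: Rabs_pos.
Qed.

Lemma cder_cexp0 : cder cexp 0%C 1%C.
Proof.
(* Increments will have modulus [m < e <= 1], so products of two of them also count as multiples of
   [e * m]. The two coordinates contribute [3 * (e * m)] and [5 * (e * m)], below [10 * (e * m)]. *)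
move=> eps e0; pose e := Rmin 1 (eps / 10).
have e1 : 0 < e by apply: Rmin_pos; lra.
have e1' : e <= 1 by exact: Rmin_l.
have e2 : e <= eps / 10 by exact: Rmin_r.
have [d1 [p1 H1]] := derivable_pt_lim_0_bound e1 derivable_pt_lim_exp_0.
have [d2 [p2 H2]] := derivable_pt_lim_0_bound e1 derivable_pt_lim_sin_0.
have [d3 [p3 H3]] := derivable_pt_lim_0_bound e1 derivable_pt_lim_cos_0.
exists (Rmin (Rmin d1 d2) (Rmin d3 e)); split.
  by do 2?[apply: Rmin_pos].
move=> [x y] Hh.
have {}Hh1 := Rlt_le_trans _ _ _ Hh (Rmin_l _ _).
have {}Hh2 := Rlt_le_trans _ _ _ Hh (Rmin_r _ _).
have Ha := Rlt_le_trans _ _ _ Hh1 (Rmin_l _ _).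
have Hb := Rlt_le_trans _ _ _ Hh1 (Rmin_r _ _).
have Hc := Rlt_le_trans _ _ _ Hh2 (Rmin_l _ _).
have Hd := Rlt_le_trans _ _ _ Hh2 (Rmin_r _ _).
have Hx := abs_re_le_Cmod (x, y); have Hy := abs_im_le_Cmod (x, y).
set m := Cmod (x, y) in Ha Hb Hc Hd Hx Hy *; cbn [fst snd] in Hx, Hy.
have := H1 x ltac:(lra); have := H2 y ltac:(lra); have := H3 y ltac:(lra).
rewrite exp_0 sin_0 cos_0 => B3 B2 B1.
have x0 := Rabs_pos x; have y0 := Rabs_pos y.
have ex : e * Rabs x <= e * m by apply: Rmult_le_compat_l; lra.
have ey : e * Rabs y <= e * m by apply: Rmult_le_compat_l; lra.
apply: Rle_trans (Cmod_le_abs _) _ => /=.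
rewrite !(Rplus_0_l, exp_0, sin_0, cos_0).
have E1 : Rabs (exp x * cos y + - (1 * 1) + - (1 * x - 0 * y)) <= 3 * (e * m).
  have -> : exp x * cos y + - (1 * 1) + - (1 * x - 0 * y) =
    (exp x - 1 - 1 * x) * cos y + (1 + x) * (cos y - 1 - 0 * y) by ring.
  apply: Rle_trans (Rabs_triang _ _) _; rewrite !Rabs_mult.
  have C1 : Rabs (cos y) <= 1 by apply: Rabs_le; have := COS_bound y; lra.
  have C2 : Rabs (1 + x) <= 2.
    by apply: Rle_trans (Rabs_triang _ _) _; rewrite Rabs_R1; lra.
  have P1 := Rmult_le_compat _ _ _ _ (Rabs_pos _) (Rabs_pos _) B1 C1.
  have P2 := Rmult_le_compat _ _ _ _ (Rabs_pos _) (Rabs_pos _) C2 B3.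
  lra.
have E2 : Rabs (exp x * sin y + - (1 * 0) + - (1 * y + 0 * x)) <= 5 * (e * m).
  have -> : exp x * sin y + - (1 * 0) + - (1 * y + 0 * x) =
    ((exp x - 1 - 1 * x) + x) * ((sin y - 0 - 1 * y) + y) + (sin y - 0 - 1 * y) by ring.
  apply: Rle_trans (Rabs_triang _ _) _; rewrite !Rabs_mult.
  have ex1 : e * Rabs x <= 1 * Rabs x by apply: Rmult_le_compat_r; lra.
  have C1 : Rabs (exp x - 1 - 1 * x + x) <= 2 * e.
    by apply: Rle_trans (Rabs_triang _ _) _; lra.
  have ey1 : e * Rabs y <= 1 * Rabs y by apply: Rmult_le_compat_r; lra.
  have C2 : Rabs (sin y - 0 - 1 * y + y) <= 2 * m.
    by apply: Rle_trans (Rabs_triang _ _) _; lra.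
  have P1 := Rmult_le_compat _ _ _ _ (Rabs_pos _) (Rabs_pos _) C1 C2.
  lra.
have m0 : 0 <= m by exact: Cmod_ge_0.
have em : e * m <= eps / 10 * m by apply: Rmult_le_compat_r; lra.
have := Rmult_le_pos _ _ (Rlt_le _ _ e0) m0; lra.
Qed.

Lemma cder_cexp (z : C) : cder cexp z (cexp z).
Proof.
have H : cder (fun w => cexp z * cexp (w + - z))%C z
  (0 * cexp (z + - z) + cexp z * (1 * (1 + 0)))%C.
  apply: (cder_mult (cder_const (cexp z) z)).
  apply: (@cder_comp cexp (fun w => w + - z)%C).
    exact: cder_plus (cder_id z) (cder_const _ z).
  have -> : (z + - z = 0)%C by ring.
  exact: cder_cexp0.
have -> : cexp z = (0 * cexp (z + - z) + cexp z * (1 * (1 + 0)))%C by ring.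
apply: cder_ext Rlt_0_1 _ H => w _.
by rewrite -cexp_plus; congr cexp; ring.
Qed.

(* The integral of [h o cexp] over a vertical segment of height [2 pi] does not
   depend on its abscissa, and tends to [2 pi L] as the abscissa tends to
   minus infinity. *)
Lemma circle_bound (h : C -> C) (L : C) (r R0 K : R) : 0 < r < R0 ->
  (forall u, 0 < Cmod u < R0 -> exists l, cder h u l) ->
  (forall eps, 0 < eps -> exists delta, 0 < delta /\
     forall u, 0 < Cmod u < delta -> Cmod (h u - L) <= eps) ->
  (forall u, Cmod u = r -> Cmod (h u) <= K) -> Cmod L <= 2 * K.
Proof.
move=> [r0 rR] Hd HL HK.
apply: le_epsilon => eps e0.
have [del [d0 Hdel]] := HL (eps / 2) ltac:(lra).
pose s := Rmin r (del / 2).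
have s0 : 0 < s by apply: Rmin_pos; lra.
have sr : s <= r := Rmin_l _ _.
have sd : s < del by have := Rmin_r r (del / 2); rewrite -/s; lra.
have PI0 := PI_RGT_0.
pose g z := h (cexp z).
have cx x : x <= ln r -> 0 < exp x < R0.
  move=> Hx; split; first exact: exp_pos.
  apply: Rle_lt_trans rR; case: Hx => [/exp_increasing|->]; rewrite exp_ln //; lra.
have lsr : ln s <= ln r by case: sr => [/(ln_increasing _ _ s0)|->]; lra.
have Hg x y : ln s <= x <= ln r -> 0 <= y <= 2 * PI -> exists l, cder g (x, y) l.
  move=> Hx _; have [l Hl] := Hd (cexp (x, y)) ltac:(rewrite Cmod_cexp; apply: cx => /=; lra).
  by eexists; apply: (cder_comp (cder_cexp _) Hl).
have G := goursat lsr (ltac:(lra) : 0 <= 2 * PI) Hg.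
have Hc : cont_rect g (ln s) (ln r) 0 (2 * PI).
  by move=> x y Hx Hy; have [l Hl] := Hg x y Hx Hy; exact: cder_cont Hl.
have vs := cont_rect_v Hc (conj (Rle_refl _) lsr).
have vr := cont_rect_v Hc (conj lsr (Rle_refl _)).
(* The period [2 * PI * Ci] of [cexp] makes the two horizontal sides cancel. *)
have per : (fun x => g (x, 0)) = (fun x => g (x, 2 * PI)).
  apply: functional_extensionality => x; rewrite /g /cexp /=.
  by rewrite cos_2PI sin_2PI cos_0 sin_0.
have V : cint (fun y => g (ln r, y)) 0 (2 * PI) = cint (fun y => g (ln s, y)) 0 (2 * PI).
  move: G; rewrite /bdry per.
  set A := cint _ _ _; set A1 := cint _ 0 _; set A2 := cint _ 0 _ => G.
  apply: Csub_eq0.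
  have -> : (A1 - A2 = - Ci * (A - A + Ci * (A1 - A2)))%C.
    by apply: injective_projections => /=; ring.
  by rewrite G; ring.
have B1 : Cmod (cint (fun y => g (ln r, y)) 0 (2 * PI)) <= 2 * K * (2 * PI - 0).
  apply: cint_bound => //; first lra.
  by move=> t _; apply: HK; rewrite Cmod_cexp /= exp_ln.
have I := cint_minus (ltac:(lra) : 0 <= 2 * PI) vs (pcont_const L (a := 0) (b := 2 * PI)).
have B2 : Cmod (cint (fun y => g (ln s, y) - L)%C 0 (2 * PI)) <= 2 * (eps / 2) * (2 * PI - 0).
  apply: cint_bound; [lra | by apply: pcont_minus => //; exact: pcont_const |].
  by move=> t _; apply: Hdel; rewrite Cmod_cexp /= exp_ln.
rewrite cint_const in I.
have E : (L * RtoC (2 * PI - 0) = cint (fun y => g (ln r, y)) 0 (2 * PI) +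
   - cint (fun y => g (ln s, y) - L) 0 (2 * PI))%C by rewrite I V; ring.
have : Cmod L * (2 * PI) <= (2 * K + eps) * (2 * PI).
  have <- : Cmod (L * RtoC (2 * PI - 0)) = Cmod L * (2 * PI).
    by rewrite Cmod_mult Cmod_R Rminus_0_r Rabs_pos_eq; lra.
  rewrite E; apply: Rle_trans (Cmod_triangle _ _) _; rewrite Cmod_opp; lra.
by apply: Rmult_le_reg_r; lra.
Qed.

(** * Derivative bounds and Taylor remainders in one variable *)

Definition hol (r : R) (f f' : C -> C) : Prop := forall z, Cmod z < r -> cder f z (f' z).

Lemma cder_shift (f : C -> C) (w z l : C) : cder f (w + z)%C l ->
  cder (fun u => f (w + u)%C) z l.
Proof.
move=> H; have -> : l = (l * (0 + 1))%C by ring.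
apply: (cder_comp (g := fun u => (w + u)%C)) => //.
exact: cder_plus (cder_const w z) (cder_id z).
Qed.

Lemma hol_shift (r s : R) (f f' : C -> C) (w : C) : Cmod w + s <= r -> hol r f f' ->
  hol s (fun u => f (w + u)%C) (fun u => f' (w + u)%C).
Proof.
move=> ws H z Hz; apply: cder_shift; apply: H.
by apply: Rle_lt_trans (Cmod_triangle _ _) _; lra.
Qed.

(** [circle_bound] for the difference quotient at 0, which is at most [4 * M / r] on the circle of
    radius [r / 2]. *)
Lemma cauchy_estimate (r M : R) (f f' : C -> C) : 0 < r -> hol r f f' ->
  (forall z, Cmod z < r -> Cmod (f z) <= M) -> Cmod (f' 0) <= 8 * M / r.
Proof.
move=> r0 H HM.
have c0 : Cmod 0 < r by rewrite Cmod_0.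
have -> : 8 * M / r = 2 * (2 * M / (r / 2)) by field; lra.
apply: (@circle_bound (fun u => (f u + - f 0) * / u)%C (f' 0) (r / 2) r); first lra.
- move=> u [u0 ur]; eexists; apply: cder_mult.
    by apply: cder_plus; [exact: H | exact: cder_const].
  by apply: cder_inv; apply/Cmod_gt_0.
- move=> eps e0; have [d [d0 Hd]] := H _ c0 eps e0.
  exists d; split=> // u [u0 ud].
  have un : u <> 0%C by apply/Cmod_gt_0.
  have -> : ((f u + - f 0) * / u - f' 0 = (f (0 + u) - f 0 - f' 0 * u) / u)%C.
    by rewrite Cplus_0_l; field.
  by rewrite Cmod_div //; apply/Rle_div_l => //; apply: Hd.
- move=> u Hu.
  have un : u <> 0%C by apply/Cmod_gt_0; lra.
  rewrite Cmod_mult Cmod_inv // Hu; apply: Rmult_le_compat_r.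
    by apply: Rlt_le; apply: Rinv_0_lt_compat; lra.
  apply: Rle_trans (Cmod_triangle _ _) _; rewrite Cmod_opp.
  by have := HM u ltac:(lra); have := HM _ c0; lra.
Qed.

(** The real mean value theorem along the segment from 0 to [t], for real and imaginary parts
    separately; hence the factor 2. *)
Lemma cmvt (f f' : C -> C) (t : C) (K : R) :
  (forall s, 0 <= s <= 1 -> cder f (RtoC s * t)%C (f' (RtoC s * t)%C) /\
                          Cmod (f' (RtoC s * t)%C) <= K) ->
  Cmod (f t - f 0) <= 2 * (K * Cmod t).
Proof.
move=> H.
have path s : 0 <= s <= 1 -> forall eps, 0 < eps -> exists delta, 0 < delta /\
   forall h, Rabs h < delta ->
   Cmod (f (RtoC (s + h)%R * t)%C - f (RtoC s * t)%C - RtoC h * (f' (RtoC s * t)%C * t)) <= eps * Rabs h.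
  move=> Hs eps e0; have [Hd _] := H s Hs.
  have t0 := Cmod_ge_0 t.
  have e1 : 0 < eps / (Cmod t + 1) by apply: Rdiv_lt_0_compat; lra.
  have [d [d0 Hdel]] := Hd _ e1.
  have d1 : 0 < d / (Cmod t + 1) by apply: Rdiv_lt_0_compat; lra.
  exists (d / (Cmod t + 1)); split=> // h Hh.
  have Hm : Cmod (RtoC h * t) <= Rabs h * (Cmod t + 1).
    by rewrite Cmod_mult Cmod_R; apply: Rmult_le_compat_l; [exact: Rabs_pos | lra].
  have := Hdel (RtoC h * t)%C.
  have -> : (RtoC s * t + RtoC h * t = RtoC (s + h)%R * t)%C by rewrite RtoC_plus; ring.
  have -> : (f' (RtoC s * t)%C * (RtoC h * t) = RtoC h * (f' (RtoC s * t)%C * t))%C by ring.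
  move=> HH; apply: Rle_trans (HH _) _.
    apply: Rle_lt_trans Hm _; apply/Rlt_div_r => //; lra.
  have -> : eps * Rabs h = eps / (Cmod t + 1) * (Rabs h * (Cmod t + 1)) by field; lra.
  by apply: Rmult_le_compat_l => //; lra.
have K0 s : 0 <= s <= 1 -> Cmod (f' (RtoC s * t)%C * t) <= K * Cmod t.
  move=> Hs; rewrite Cmod_mult; apply: Rmult_le_compat_r; first exact: Cmod_ge_0.
  by have [] := H s Hs.
have comp (pr : C -> R) : (forall z w, pr (z - w)%C = pr z - pr w) ->
    (forall h z, pr (RtoC h * z)%C = h * pr z) -> (forall z, Rabs (pr z) <= Cmod z) ->
    Rabs (pr (f t - f 0)%C) <= K * Cmod t.
  move=> prB prZ prM.
  pose F s := pr (f (RtoC s * t)%C); pose dF s := pr (f' (RtoC s * t)%C * t)%C.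
  have HF s : 0 <= s <= 1 -> derivable_pt_lim F s (dF s).
    move=> Hs eps e0; have [d [d0 Hd]] := path s Hs (eps / 2) ltac:(lra).
    exists (mkposreal d d0) => h h0 /= Hh.
    have a0 : 0 < Rabs h by apply: Rabs_pos_lt.
    have -> : (F (s + h) - F s) / h - dF s = (F (s + h) - F s - h * dF s) / h by field.
    rewrite Rabs_div //; apply: (Rle_lt_trans _ (eps / 2)); last lra.
    apply/Rle_div_l => //; apply: Rle_trans (Hd h Hh).
    by rewrite /F /dF -prZ -!prB.
  have [c [Hc Ec]] : exists c, Rmin 0 1 <= c <= Rmax 0 1 /\ F 1 - F 0 = dF c * (1 - 0).
    apply: (MVT_gen F 0 1 dF) => s; rewrite (Rmin_left _ _ Rle_0_1) (Rmax_right _ _ Rle_0_1) => Hs.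
    - by apply/is_derive_Reals; apply: HF; lra.
    - apply: derivable_continuous_pt; exists (dF s); apply: HF; lra.
  have -> : pr (f t - f 0)%C = dF c.
    rewrite prB; move: Ec; rewrite /F Cmult_0_l Cmult_1_l; lra.
  apply: Rle_trans (prM _) _; apply: K0; move: Hc; rewrite (Rmin_left _ _ Rle_0_1) (Rmax_right _ _ Rle_0_1); lra.
apply: Rle_trans (Cmod_le_abs _) _.
have := comp fst (fun z w => erefl) (fun h z => ltac:(rewrite /=; ring)) abs_re_le_Cmod.
have := comp snd (fun z w => erefl) (fun h z => ltac:(rewrite /=; ring)) abs_im_le_Cmod.
lra.
Qed.

Lemma hol_deriv_bound (r M : R) (f f' : C -> C) (z : C) : 0 < r -> hol r f f' ->
  (forall z, Cmod z < r -> Cmod (f z) <= M) -> Cmod z <= r / 2 ->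
  Cmod (f' z) <= 16 * M / r.
Proof.
move=> r0 H HM Hz.
have -> : 16 * M / r = 8 * M / (r / 2) by field; lra.
rewrite -[z in f' z]Cplus_0_r.
apply: (cauchy_estimate (f := fun u => f (z + u)%C) (f' := fun u => f' (z + u)%C)); first lra.
- by apply: hol_shift H; lra.
- by move=> w Hw; apply: HM; apply: Rle_lt_trans (Cmod_triangle _ _) _; lra.
Qed.

Lemma hol_lipschitz (r M : R) (f f' : C -> C) (z w : C) : 0 < r -> hol r f f' ->
  (forall z, Cmod z < r -> Cmod (f z) <= M) -> Cmod z <= r / 2 -> Cmod w <= r / 2 ->
  Cmod (f w - f z) <= 32 * M / r * Cmod (w - z).
Proof.
move=> r0 H HM Hz Hw.
have -> : 32 * M / r * Cmod (w - z) = 2 * (16 * M / r * Cmod (w - z)) by field; lra.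
have {1}-> : w = (z + (w - z))%C by ring.
rewrite -[z in (_ - f z)%C]Cplus_0_r.
apply: (cmvt (f := fun u => f (z + u)%C) (f' := fun u => f' (z + u)%C)) => s Hs.
have Hs' : Cmod (z + RtoC s * (w - z)) <= r / 2.
  have -> : (z + RtoC s * (w - z) = RtoC (1 - s)%R * z + RtoC s * w)%C.
    by rewrite RtoC_minus; ring.
  apply: Rle_trans (Cmod_triangle _ _) _; rewrite !Cmod_mult !Cmod_R !Rabs_pos_eq; try lra.
  have A := Rmult_le_compat_l (1 - s) _ _ ltac:(lra) Hz.
  have B := Rmult_le_compat_l s _ _ ltac:(lra) Hw.
  lra.
split; first by apply: cder_shift; apply: H; lra.
exact: hol_deriv_bound H HM Hs'.
Qed.

(** [f'] is not yet known to be differentiable. Its Lipschitz bound at 0 comes instead from Cauchy's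
    estimate for [u |-> f (s + u) - f u], which [hol_lipschitz] bounds by a multiple of [|s|]; then
    [cmvt] applies to [f u - f' 0 * u]. *)
Lemma hol_second_order (r M : R) (f f' : C -> C) (t : C) : 0 < r -> hol r f f' ->
  (forall z, Cmod z < r -> Cmod (f z) <= M) -> Cmod t <= r / 4 ->
  Cmod (f t - f 0 - f' 0 * t) <= 2048 * M / r ^ 2 * Cmod t ^ 2.
Proof.
move=> r0 H HM Ht.
have c0 : Cmod 0 < r by rewrite Cmod_0.
have M0 : 0 <= M by apply: Rle_trans (HM _ c0); exact: Cmod_ge_0.
have D s : Cmod s <= r / 4 -> Cmod (f' s - f' 0) <= 1024 * M / r ^ 2 * Cmod s.
  move=> Hs.
  have -> : 1024 * M / r ^ 2 * Cmod s = 8 * (32 * M / r * Cmod s) / (r / 4) by field; lra.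
  have := @cauchy_estimate (r / 4) (32 * M / r * Cmod s)
     (fun u => f (s + u)%C + RtoC (-1) * f u)%C
     (fun u => f' (s + u)%C + (0 * f u + RtoC (-1) * f' u))%C ltac:(lra).
  have -> : (f' (s + 0)%C + (0 * f 0 + RtoC (-1) * f' 0) = f' s - f' 0)%C.
    by rewrite Cplus_0_r; apply: injective_projections => /=; ring.
  apply.
  - move=> z Hz; apply: cder_plus.
      by apply: cder_shift; apply: H; apply: Rle_lt_trans (Cmod_triangle _ _) _; lra.
    by apply: (cder_mult (cder_const _ z)); apply: H; lra.
  - move=> z Hz.
    have -> : (f (s + z)%C + RtoC (-1) * f z = f (s + z)%C - f z)%C.
      by apply: injective_projections => /=; ring.
    have {2}-> : s = (s + z - z)%C by ring.
    apply: hol_lipschitz H HM _ _ => //; first lra.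
    by apply: Rle_trans (Cmod_triangle _ _) _; lra.
have := @cmvt (fun u => f u + - f' 0 * u)%C (fun u => f' u + (0 * u + - f' 0 * 1))%C t
  (1024 * M / r ^ 2 * Cmod t).
have -> : (f t + - f' 0 * t - (f 0 + - f' 0 * 0) = f t - f 0 - f' 0 * t)%C by ring.
have -> : 2048 * M / r ^ 2 * Cmod t ^ 2 = 2 * (1024 * M / r ^ 2 * Cmod t * Cmod t) by field; lra.
apply=> s Hs.
have Hst : Cmod (RtoC s * t) <= Cmod t.
  rewrite Cmod_mult Cmod_R Rabs_pos_eq; last lra.
  rewrite -[X in _ <= X]Rmult_1_l; apply: Rmult_le_compat_r; [exact: Cmod_ge_0 | lra].
split.
  apply: cder_plus; first by apply: H; lra.
  exact: (cder_mult (cder_const _ _) (cder_id _)).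
have -> : (f' (RtoC s * t)%C + (0 * (RtoC s * t) + - f' 0 * 1) = f' (RtoC s * t)%C - f' 0)%C by ring.
apply: Rle_trans (D _ _) _; first lra.
apply: Rmult_le_compat_l => //.
apply: Rmult_le_pos; first lra.
by apply: Rlt_le; apply: Rinv_0_lt_compat; apply: pow_lt.
Qed.

(** This is [circle_bound] for [/ f], whose factor 2 it inherits. *)
Lemma min_modulus (r s eta : R) (f f' : C -> C) : 0 < s < r -> 0 < eta -> hol r f f' ->
  (forall z, Cmod z < r -> f z <> 0%C) ->
  (forall z, Cmod z = s -> eta <= Cmod (f z)) -> eta <= 2 * Cmod (f 0).
Proof.
move=> Hs e0 H nz He.
have c0 : Cmod 0 < r by rewrite Cmod_0; lra.
have m0 : 0 < Cmod (f 0) by apply/Cmod_gt_0; exact: nz.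
have dinv z : Cmod z < r -> exists l, cder (fun u => / f u)%C z l.
  move=> Hz; eexists; apply: (cder_comp (f := Cinv)); first exact: H.
  by apply: cder_inv; exact: nz.
have : Cmod (/ f 0) <= 2 * / eta.
  apply: (@circle_bound (fun u => / f u)%C _ s r) => //.
  - by move=> u [_ Hu]; exact: dinv.
  - move=> eps p0; have [l /cder_cont Hl] := dinv _ c0.
    have [d [d0 Hd]] := Hl eps p0; exists d; split=> // u [_ Hu].
    apply: Rlt_le; apply: Hd; have -> : (u - 0 = u)%C by ring.
    by [].
  - move=> u Hu; rewrite Cmod_inv; last by apply: nz; lra.
    by apply: Rinv_le_contravar => //; exact: He.
rewrite Cmod_inv; last exact: nz.
move=> /(Rmult_le_compat_r (eta * Cmod (f 0)) _ _ ltac:(nra)).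
have -> : / Cmod (f 0) * (eta * Cmod (f 0)) = eta by field; lra.
have -> : 2 * / eta * (eta * Cmod (f 0)) = 2 * Cmod (f 0) by field; lra.
by [].
Qed.

(** * Several variables *)

Section Vectors.
Context {n : nat}.
Implicit Types (u v w z h x c : Vec n) (l : list 'I_n).

(** An arbitrary list of coordinates makes induction possible. *)
Definition lnorm l v : R :=
  sqrt (List.fold_right (fun k acc => (Cmod (v k) ^ 2 + acc)%R) 0%R l).

(** Reading the pair as a complex number turns the triangle inequality for [Cmod] into the induction
    step of Minkowski's inequality. *)
Lemma lnorm_cons k l v : lnorm (k :: l) v = Cmod (Cmod (v k), lnorm l v).
Proof.
have E a b : Cmod (a, b) = sqrt (a ^ 2 + b ^ 2) by [].
rewrite E /lnorm pow2_sqrt //.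
elim: l => [|j l IH] /=; first lra.
by apply: Rplus_le_le_0_compat => //; exact: pow2_ge_0.
Qed.

Lemma Cmod_mono (a b a' b' : R) : 0 <= a <= a' -> 0 <= b <= b' -> Cmod (a, b) <= Cmod (a', b').
Proof.
move=> Ha Hb; apply: sqrt_le_1_alt => /=.
by apply: Rplus_le_compat; nra.
Qed.

Lemma lnorm_ge0 l v : 0 <= lnorm l v.
Proof. exact: sqrt_pos. Qed.

Lemma lnorm_triangle l u v : lnorm l (vadd u v) <= lnorm l u + lnorm l v.
Proof.
elim: l => [|k l IH]; first by rewrite /lnorm /= sqrt_0; lra.
rewrite !lnorm_cons; apply: Rle_trans (Cmod_triangle (_, _) (_, _)).
apply: Cmod_mono; split; [exact: Cmod_ge_0 | exact: Cmod_triangle | exact: lnorm_ge0 | exact: IH].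
Qed.

Lemma lnorm_scal l (t : C) v : lnorm l (vscal t v) = Cmod t * lnorm l v.
Proof.
elim: l => [|k l IH]; first by rewrite /lnorm /= sqrt_0; lra.
rewrite !lnorm_cons IH /vscal Cmod_mult.
have -> : (Cmod t * Cmod (v k), Cmod t * lnorm l v) = (RtoC (Cmod t) * (Cmod (v k), lnorm l v))%C.
  by apply: injective_projections => /=; ring.
by rewrite Cmod_mult Cmod_R Rabs_pos_eq //; exact: Cmod_ge_0.
Qed.

Lemma lnorm_le_sum l v (e : R) : (forall k, Cmod (v k) <= e) -> lnorm l v <= INR (size l) * e.
Proof.
move=> H; elim: l => [|k l IH]; first by rewrite /lnorm /= sqrt_0; lra.
rewrite lnorm_cons; apply: Rle_trans (Cmod_le_abs _) _; cbn [fst snd size].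
rewrite S_INR !Rabs_pos_eq; [|exact: lnorm_ge0 | exact: Cmod_ge_0].
by have := H k; lra.
Qed.

Lemma Cmod_le_lnorm l v k : k \in l -> Cmod (v k) <= lnorm l v.
Proof.
elim: l => [//|j l IH]; rewrite in_cons lnorm_cons => /orP [/eqP <-|/IH H].
  by apply: Rle_trans (abs_re_le_Cmod _) => /=; exact: Rle_abs.
apply: Rle_trans H _; apply: Rle_trans (abs_im_le_Cmod _) => /=; exact: Rle_abs.
Qed.

Lemma vnorm_ge0 v : 0 <= vnorm v.
Proof. exact: lnorm_ge0. Qed.

Lemma vnorm_triangle u v : vnorm (vadd u v) <= vnorm u + vnorm v.
Proof. exact: lnorm_triangle. Qed.

Lemma vnorm_scal (t : C) v : vnorm (vscal t v) = Cmod t * vnorm v.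
Proof. exact: lnorm_scal. Qed.

Lemma Cmod_le_vnorm v k : Cmod (v k) <= vnorm v.
Proof. by apply: Cmod_le_lnorm; rewrite mem_enum. Qed.

Lemma vnorm_le_sum v (e : R) : (forall k, Cmod (v k) <= e) -> vnorm v <= INR n * e.
Proof. by move=> /(lnorm_le_sum (enum 'I_n)); rewrite -cardE card_ord. Qed.

Lemma vnorm_sub_sym u v : vnorm (vsub u v) = vnorm (vsub v u).
Proof.
have -> : vsub u v = vscal (RtoC (-1)) (vsub v u).
  apply: functional_extensionality => k; rewrite /vsub /vscal.
  by apply: injective_projections => /=; ring.
by rewrite vnorm_scal Cmod_R Rabs_left; lra.
Qed.

Lemma vnorm_sub_triangle u v w : vnorm (vsub u w) <= vnorm (vsub u v) + vnorm (vsub v w).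
Proof.
have -> : vsub u w = vadd (vsub u v) (vsub v w).
  by apply: functional_extensionality => k; rewrite /vsub /vadd; ring.
exact: vnorm_triangle.
Qed.

Lemma vnorm_eq0 v : vnorm v = 0 -> v = fun _ => 0%C.
Proof.
move=> H; apply: functional_extensionality => k; apply: Cmod_eq_0.
by have := Cmod_le_vnorm v k; have := Cmod_ge_0 (v k); lra.
Qed.

Lemma vnorm_sub_refl v : vnorm (vsub v v) = 0.
Proof.
have -> : vsub v v = vscal 0%C v.
  by apply: functional_extensionality => k; rewrite /vsub /vscal; ring.
by rewrite vnorm_scal Cmod_0; ring.
Qed.

Lemma vadd_sub u v : vadd u (vsub v u) = v.
Proof. by apply: functional_extensionality => k; rewrite /vsub /vadd; ring. Qed.

Lemma vsub_add u v : vsub (vadd u v) u = v.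
Proof. by apply: functional_extensionality => k; rewrite /vsub /vadd; ring. Qed.

Lemma vscal0 v : vscal 0%C v = fun _ => 0%C.
Proof. by apply: functional_extensionality => k; rewrite /vscal; ring. Qed.

Lemma vadd0 u v : vadd u (vscal 0%C v) = u.
Proof. by apply: functional_extensionality => k; rewrite /vadd /vscal; ring. Qed.

Lemma vscal1 v : vscal 1%C v = v.
Proof. by apply: functional_extensionality => k; rewrite /vscal; ring. Qed.

Lemma vadd_line z h (t s : C) :
  vadd z (vscal (t + s)%C h) = vadd (vadd z (vscal t h)) (vscal s h).
Proof. by apply: functional_extensionality => k; rewrite /vadd /vscal; ring. Qed.

Lemma vnorm_ebasis k : vnorm (ebasis k : Vec n) <= 1.
Proof.
rewrite /vnorm -/(lnorm _ _).
have : uniq (enum 'I_n) by exact: enum_uniq.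
have out l : k \notin l -> lnorm l (ebasis k) = 0.
  elim: l => [|j l IH]; first by rewrite /lnorm /= sqrt_0.
  rewrite in_cons negb_or lnorm_cons => /andP [kj /IH ->].
  by rewrite /ebasis eq_sym (negbTE kj) Cmod_0 Cmod_0.
elim: (enum 'I_n) => [|j l IH]; first by rewrite /lnorm /= sqrt_0; lra.
rewrite cons_uniq lnorm_cons => /andP [jl /IH H].
case: (altP (j =P k)) => [jk|jk].
  rewrite out -?jk // /ebasis eqxx Cmod_1.
  by have E := Cmod_1; rewrite /RtoC in E; rewrite E; lra.
rewrite /ebasis (negbTE jk) Cmod_0 -/(ebasis k).
apply: Rle_trans (Cmod_le_abs _) _ => /=; rewrite Rabs_R0 Rabs_pos_eq; first lra.
exact: lnorm_ge0.
Qed.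

Lemma vdot_scal c (t : C) h : vdot c (vscal t h) = (t * vdot c h)%C.
Proof.
rewrite /vdot; elim: (enum 'I_n) => [|k l IH] /=; first by ring.
by rewrite IH /vscal; ring.
Qed.

Lemma vdot_ebasis c k : vdot c (ebasis k) = c k.
Proof.
rewrite /vdot.
have : uniq (enum 'I_n) by exact: enum_uniq.
have : k \in enum 'I_n by rewrite mem_enum.
have out l : k \notin l -> List.fold_right (fun j acc => c j * ebasis k j + acc)%C 0%C l = 0%C.
  elim: l => [//|j l IH]; rewrite in_cons negb_or => /andP [kj /IH /= ->].
  by rewrite /ebasis eq_sym (negbTE kj); ring.
elim: (enum 'I_n) => [//|j l IH]; rewrite in_cons cons_uniq => /orP [/eqP <-|kl] /andP [jl Hl] /=.
  by rewrite out // /ebasis eqxx; ring.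
rewrite IH // /ebasis; case: (altP (j =P k)) => [jk|_]; last by ring.
by rewrite -jk (negbTE jl) in kl.
Qed.

(** [cdiff] hides the vector [c] under an existential; uniqueness and limits need it by name. *)
Definition is_grad (F : Vec n -> C) z c : Prop :=
  forall eps, 0 < eps -> exists delta, 0 < delta /\
    forall h, vnorm h < delta -> Cmod (F (vadd z h) - F z - vdot c h) <= eps * vnorm h.

Definition grad (F : Vec n -> C) z : Vec n := fun k => pderiv k F z.

Lemma is_pderiv_uniq (F : Vec n -> C) k z (a b : C) :
  is_pderiv F k z a -> is_pderiv F k z b -> a = b.
Proof.
move=> Ha Hb; apply: Csub_eq0; apply: Cmod_eq_0.
apply: Rle_antisym; last exact: Cmod_ge_0.
apply: le_epsilon => eps e0.
have [d [d0 Hd]] := Ha (eps / 2) ltac:(lra).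
have [d' [d0' Hd']] := Hb (eps / 2) ltac:(lra).
have m0 : 0 < Rmin d d' by exact: Rmin_pos.
have hm : Cmod (RtoC (Rmin d d' / 2)) < Rmin d d' by rewrite Cmod_R Rabs_pos_eq; lra.
have h0 : RtoC (Rmin d d' / 2) <> 0%C by move=> /RtoC_inj; lra.
have := Hd _ h0 (Rlt_le_trans _ _ _ hm (Rmin_l _ _)).
have := Hd' _ h0 (Rlt_le_trans _ _ _ hm (Rmin_r _ _)).
set q := (_ / _)%C => Q1 Q2.
have -> : (a - b = (q - b) + - (q - a))%C by ring.
by apply: Rle_trans (Cmod_triangle _ _) _; rewrite Cmod_opp; lra.
Qed.

Lemma pderiv_eq (F : Vec n -> C) k z (a : C) : is_pderiv F k z a -> pderiv k F z = a.
Proof.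
move=> H; apply: (is_pderiv_uniq _ H).
exact: (epsilon_spec _ _ (ex_intro _ a H)).
Qed.

Lemma is_grad_line (F : Vec n -> C) z c h (t : C) : is_grad F (vadd z (vscal t h)) c ->
  cder (fun s => F (vadd z (vscal s h))) t (vdot c h).
Proof.
move=> H eps e0; have h0 := vnorm_ge0 h.
(* The [+ 1] covers the direction [h = 0]. *)
have e1 : 0 < eps / (vnorm h + 1) by apply: Rdiv_lt_0_compat; lra.
have [d [d0 Hd]] := H _ e1.
exists (d / (vnorm h + 1)); split; first by apply: Rdiv_lt_0_compat; lra.
move=> s Hs; rewrite vadd_line; have s0 := Cmod_ge_0 s.
have Hsh : Cmod s * vnorm h <= Cmod s * (vnorm h + 1) by apply: Rmult_le_compat_l; lra.
have := Hd (vscal s h); rewrite vnorm_scal vdot_scal Cmult_comm => HH.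
apply: Rle_trans (HH _) _.
  by apply: Rle_lt_trans Hsh _; apply/Rlt_div_r; lra.
have -> : eps * Cmod s = eps / (vnorm h + 1) * (Cmod s * (vnorm h + 1)) by field; lra.
by apply: Rmult_le_compat_l; lra.
Qed.

Lemma is_grad_pderiv (F : Vec n -> C) z c k : is_grad F z c -> is_pderiv F k z (c k).
Proof.
move=> H eps e0.
have H' : is_grad F (vadd z (vscal 0%C (ebasis k))) c by rewrite vadd0.
have [d [d0 Hd]] := is_grad_line H' (eps := eps / 2) ltac:(lra).
exists d; split=> // h h0 Hh; have := Hd h Hh.
rewrite Cplus_0_l vadd0 vdot_ebasis => B.
have m0 : 0 < Cmod h by apply/Cmod_gt_0.
have -> : ((F (vadd z (vscal h (ebasis k))) - F z) / h - c k =
  (F (vadd z (vscal h (ebasis k))) - F z - c k * h) / h)%C by field.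
rewrite Cmod_div //; apply: (Rle_lt_trans _ (eps / 2)); last lra.
by apply/Rle_div_l.
Qed.

Lemma is_grad_eq (F : Vec n -> C) z c : is_grad F z c -> c = grad F z.
Proof.
move=> H; apply: functional_extensionality => k.
by rewrite /grad (pderiv_eq (is_grad_pderiv k H)).
Qed.

Lemma cdiff_grad (F : Vec n -> C) z : cdiff F z -> is_grad F z (grad F z).
Proof. by case=> c Hc; rewrite -(is_grad_eq Hc). Qed.

Definition bhol (x : Vec n) (r M : R) (F : Vec n -> C) : Prop :=
  forall z, vnorm (vsub z x) < r -> cdiff F z /\ Cmod (F z) <= M.

Lemma bhol_sub x (r s M : R) F z : vnorm (vsub z x) + s <= r -> bhol x r M F -> bhol z s M F.
Proof.
move=> zs H w Hw; apply: H; have := vnorm_sub_triangle w z x; lra.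
Qed.

(** Reduces ball estimates to one variable. An upper bound [N] in place of [vnorm h] itself allows a
    zero direction. *)
Lemma bhol_line x (r M N : R) F h : 0 < N -> vnorm h <= N -> bhol x r M F ->
  hol (r / N) (fun t => F (vadd x (vscal t h)))
      (fun t => vdot (grad F (vadd x (vscal t h))) h) /\
  (forall t, Cmod t < r / N -> Cmod (F (vadd x (vscal t h))) <= M).
Proof.
move=> N0 hN H.
have in_ball t : Cmod t < r / N -> vnorm (vsub (vadd x (vscal t h)) x) < r.
  move=> Ht; rewrite vsub_add vnorm_scal.
  apply: (Rle_lt_trans _ (Cmod t * N)).
    by apply: Rmult_le_compat_l => //; exact: Cmod_ge_0.
  by apply/Rlt_div_r.
split=> t /in_ball Ht; have [Hd Hb] := H _ Ht => //.
exact: (is_grad_line (cdiff_grad Hd)).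
Qed.

Lemma bhol_pderiv x (r M : R) F k : 0 < r -> bhol x r M F -> Cmod (pderiv k F x) <= 8 * M / r.
Proof.
move=> r0 H; have [H1 H2] := bhol_line Rlt_0_1 (vnorm_ebasis k) H.
rewrite Rdiv_1_r in H1 H2.
by have := cauchy_estimate r0 H1 H2; rewrite vadd0 vdot_ebasis.
Qed.

(** On the complex line with [x] at parameter 0 and [z] at parameter 1, the disc has radius
    [r / vnorm (vsub z x)], at least 2, so both parameters lie in the half disc that [hol_lipschitz]
    asks for. *)
Lemma bhol_lipschitz x (r M : R) F z : 0 < r -> bhol x r M F -> vnorm (vsub z x) <= r / 2 ->
  Cmod (F z - F x) <= 32 * M / r * vnorm (vsub z x).
Proof.
move=> r0 H Hz; have [h0|h0] := vnorm_ge0 (vsub z x); last first.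
  rewrite -h0; have := vnorm_eq0 (esym h0) => E.
  have -> : z = x.
    by rewrite -(vadd_sub x z) E; apply: functional_extensionality => k; rewrite /vadd; ring.
  have -> : (F x - F x = 0)%C by ring.
  by rewrite Cmod_0; lra.
have [H1 H2] := bhol_line h0 (Rle_refl _) H.
have rN : 0 < r / vnorm (vsub z x) by exact: Rdiv_lt_0_compat.
have N1 : 1 <= r / vnorm (vsub z x) / 2.
  by apply: (proj1 (Rle_div_r _ _ _ _)); [lra | apply: (proj1 (Rle_div_r _ _ _ _)); lra].
have := @hol_lipschitz _ _ _ _ 0%C 1%C rN H1 H2.
rewrite vadd0 vscal1 vadd_sub Cmod_0 Cmod_1.
have -> : (1 - 0 = 1)%C by ring.
rewrite Cmod_1 => A; apply: Rle_trans (A _ _) _; try lra.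
by right; field; lra.
Qed.

Lemma bhol_second_order x (r M : R) F h : 0 < r -> bhol x r M F -> vnorm h <= r / 4 ->
  Cmod (F (vadd x h) - F x - vdot (grad F x) h) <= 2048 * M / r ^ 2 * vnorm h ^ 2.
Proof.
move=> r0 H Hh; have [h0|h0] := vnorm_ge0 h; last first.
  rewrite -h0 -(vscal1 h) vdot_scal (vnorm_eq0 (esym h0)).
  have -> : vscal 1%C (fun=> 0%C) = vscal 0%C (fun=> 0%C : C) :> Vec n.
    by apply: functional_extensionality => k; rewrite /vscal; ring.
  rewrite vadd0.
  have -> : vdot (grad F x) (fun=> 0%C) = 0%C.
    by rewrite -(vscal0 x) vdot_scal; ring.
  have -> : (F x - F x - 1 * 0 = 0)%C by ring.
  by rewrite Cmod_0; lra.
have [H1 H2] := bhol_line h0 (Rle_refl _) H.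
have rN : 0 < r / vnorm h by exact: Rdiv_lt_0_compat.
have N1 : 1 <= r / vnorm h / 4.
  by apply: (proj1 (Rle_div_r _ _ _ _)); [lra | apply: (proj1 (Rle_div_r _ _ _ _)); lra].
have := @hol_second_order _ _ _ _ 1%C rN H1 H2.
rewrite !vadd0 vscal1 Cmod_1 Cmult_1_r => A; apply: Rle_trans (A N1) _.
by right; field; lra.
Qed.

Lemma quadratic_is_grad (F : Vec n -> C) z c (K d : R) : 0 < d ->
  (forall h, vnorm h <= d -> Cmod (F (vadd z h) - F z - vdot c h) <= K * vnorm h ^ 2) ->
  is_grad F z c.
Proof.
move=> d0 H eps e0.
have K1 : 0 < Rabs K + 1 by have := Rabs_pos K; lra.
exists (Rmin d (eps / (Rabs K + 1))); split.
  by apply: Rmin_pos => //; exact: Rdiv_lt_0_compat.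
move=> h Hh.
have Hd := Rlt_le_trans _ _ _ Hh (Rmin_l _ _).
have He := Rlt_le_trans _ _ _ Hh (Rmin_r _ _).
apply: Rle_trans (H h (Rlt_le _ _ Hd)) _.
have h0 := vnorm_ge0 h.
move/Rlt_le/(Rle_div_r _ _ _ K1): He => He.
have -> : K * vnorm h ^ 2 = K * vnorm h * vnorm h by ring.
apply: Rmult_le_compat_r => //.
apply: Rle_trans He; rewrite Rmult_comm; apply: Rmult_le_compat_l => //.
by have := Rle_abs K; lra.
Qed.
End Vectors.

(** * Ultrafilter limits and saturation *)

Section Ultrafilter.
Context {U : (nat -> Prop) -> Prop} (HU : nonprincipal_ultrafilter U).

Lemma U_mono (A B : nat -> Prop) : (forall i, A i -> B i) -> U A -> U B.
Proof. by move: HU => [_ [_ [H _]]]; exact: H. Qed.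

Lemma U_and (A B : nat -> Prop) : U A -> U B -> U (fun i => A i /\ B i).
Proof. by move: HU => [_ [_ [_ [H _]]]]; exact: H. Qed.

Lemma U_mono2 (A B D : nat -> Prop) : (forall i, A i -> B i -> D i) -> U A -> U B -> U D.
Proof. by move=> H a b; apply: U_mono (U_and a b) => i []; exact: H. Qed.

Lemma U_true (A : nat -> Prop) : (forall i, A i) -> U A.
Proof. by move: HU => [H _] HA; apply: U_mono H => i _. Qed.

Lemma U_em (A : nat -> Prop) : U A \/ U (fun i => ~ A i).
Proof. by move: HU => [_ [_ [_ [_ [H _]]]]]; exact: H. Qed.

Lemma U_const (P : Prop) : U (fun _ => P) -> P.
Proof.
move: (HU) => [_ [H _]] HP; apply: NNPP => nP; apply: H.
exact: U_mono HP.
Qed.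

Lemma U_by_contra (A : nat -> Prop) : (U (fun i => ~ A i) -> False) -> U A.
Proof. by case: (U_em A). Qed.

Lemma U_ge (m : nat) : U (fun i => (m <= i)%coq_nat).
Proof.
elim: m => [|m IH]; first by apply: U_true => i; lia.
have : U (fun i => i <> m).
  by case: (U_em (fun i => i = m)) => // E; case: HU => [_ [_ [_ [_ [_ /(_ m)]]]]].
apply: U_mono2 IH => i; lia.
Qed.

Lemma approxC_refl (u : HC) : approxC U u u.
Proof.
move=> eps e0; apply: U_true => i; have -> : (u i - u i = 0)%C by ring.
by rewrite Cmod_0.
Qed.

Lemma approxC_sym (u v : HC) : approxC U u v -> approxC U v u.
Proof. by move=> H eps e0; apply: U_mono (H eps e0) => i; rewrite Cmod_sub_sym. Qed.

Lemma approxC_trans (v u w : HC) : approxC U u v -> approxC U v w -> approxC U u w.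
Proof.
move=> H1 H2 eps e0.
apply: U_mono2 (H1 (eps / 2) ltac:(lra)) (H2 (eps / 2) ltac:(lra)) => i A B.
have -> : (u i - w i = (u i - v i) + (v i - w i))%C by ring.
by apply: Rle_lt_trans (Cmod_triangle _ _) _; lra.
Qed.

Lemma approxC_plus (u v u' v' : HC) : approxC U u u' -> approxC U v v' ->
  approxC U (fun i => u i + v i)%C (fun i => u' i + v' i)%C.
Proof.
move=> H1 H2 eps e0.
apply: U_mono2 (H1 (eps / 2) ltac:(lra)) (H2 (eps / 2) ltac:(lra)) => i A B.
have -> : (u i + v i - (u' i + v' i) = (u i - u' i) + (v i - v' i))%C by ring.
by apply: Rle_lt_trans (Cmod_triangle _ _) _; lra.
Qed.

Lemma approxC_scal (c : C) (u v : HC) : approxC U u v ->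
  approxC U (fun i => c * u i)%C (fun i => c * v i)%C.
Proof.
move=> H eps e0; have c0 := Cmod_ge_0 c.
have e1 : 0 < eps / (Cmod c + 1) by apply: Rdiv_lt_0_compat; lra.
apply: U_mono (H _ e1) => i A.
have -> : (c * u i - c * v i = c * (u i - v i))%C by ring.
rewrite Cmod_mult.
have d0 := Cmod_ge_0 (u i - v i).
have : (Cmod c + 1) * Cmod (u i - v i) < (Cmod c + 1) * (eps / (Cmod c + 1)).
  by apply: Rmult_lt_compat_l; lra.
have -> : (Cmod c + 1) * (eps / (Cmod c + 1)) = eps by field; lra.
by lra.
Qed.

Lemma approxC_le (u : HC) (x : C) (M : R) : approxC U u (cstC x) ->
  U (fun i => Cmod (u i) <= M) -> Cmod x <= M.
Proof.
move=> H HM; apply: le_epsilon => eps e0; apply: U_const.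
apply: U_mono2 (H eps e0) HM => i; rewrite /cstC Cmod_sub_sym => A B.
have -> : x = ((x - u i) + u i)%C by ring.
by apply: Rle_trans (Cmod_triangle _ _) _; lra.
Qed.

Lemma approxC_uniq (u : HC) (x y : C) : approxC U u (cstC x) -> approxC U u (cstC y) -> x = y.
Proof.
move=> Hx Hy; apply: Csub_eq0; apply: Cmod_eq_0; apply: Rle_antisym; last exact: Cmod_ge_0.
apply: le_epsilon => eps e0; rewrite Rplus_0_l; apply: U_const.
apply: U_mono (approxC_trans (approxC_sym Hx) Hy e0) => i.
by rewrite /cstC; lra.
Qed.

(** The standard part is the supremum of the reals lying below [u i] for almost all [i]. *)
Lemma real_standard_part (u : nat -> R) (M : R) : U (fun i => Rabs (u i) <= M) ->
  exists x, forall eps, 0 < eps -> U (fun i => Rabs (u i - x) < eps).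
Proof.
move=> HM.
have [x [x1 x2]] : {x | is_lub (fun t => U (fun i => t <= u i)) x}.
  apply: completeness.
  - exists M => t Ht; apply: U_const.
    by apply: U_mono2 HM Ht => i A B; have := Rle_abs (u i); lra.
  - exists (- M); apply: U_mono HM => i /Rabs_le_between; lra.
exists x => eps e0.
have A : U (fun i => ~ (x + eps / 2 <= u i)).
  by case: (U_em (fun i => x + eps / 2 <= u i)) => // /x1; lra.
have B : U (fun i => x - eps / 2 <= u i).
  apply: U_by_contra => Hn; suff : x <= x - eps / 2 by lra.
  apply: x2 => t Ht; apply: U_const; apply: U_mono2 Hn Ht => i; lra.
by apply: U_mono2 A B => i ? ?; apply: Rabs_def1; lra.
Qed.

Lemma standard_part (u : HC) : boundedC U u -> exists x, approxC U u (cstC x).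
Proof.
case=> M HM.
have [x Hx] := @real_standard_part (fun i => (u i).1) M
  (U_mono (fun i => Rle_trans _ _ _ (abs_re_le_Cmod (u i))) HM).
have [y Hy] := @real_standard_part (fun i => (u i).2) M
  (U_mono (fun i => Rle_trans _ _ _ (abs_im_le_Cmod (u i))) HM).
exists (x, y) => eps e0.
apply: U_mono2 (Hx (eps / 2) ltac:(lra)) (Hy (eps / 2) ltac:(lra)) => i A B.
apply: Rle_lt_trans (Cmod_le_abs _) _ => /=.
by rewrite /Rminus in A B; lra.
Qed.

(** A diagonal choice: at index [i], take a point of the deepest nonempty level not exceeding [i].
    For fixed [m], almost every [i] is at least [m] and has level [m] nonempty, so the chosen level
    is at least [m]. *)
Lemma saturation (T : Type) (t0 : T) (A : nat -> nat -> T -> Prop) :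
  (forall m i z, A (S m) i z -> A m i z) ->
  (forall m, U (fun i => exists z, A m i z)) ->
  exists zs : nat -> T, forall m, U (fun i => A m i (zs i)).
Proof.
move=> dec HA.
pose pick i := fix pick m := match m with
  | O => epsilon (inhabits t0) (A O i)
  | S m' => if excluded_middle_informative (exists z, A (S m') i z)
            then epsilon (inhabits t0) (A (S m') i) else pick m' end.
have decs m k i z : A (m + k)%coq_nat i z -> A m i z.
  by elim: k => [|k IH]; rewrite -?plus_n_O // -plus_n_Sm => /dec.
have Hpick i m k : (exists z, A m i z) -> A m i (pick i (m + k)%coq_nat).
  move=> Hex; elim: k => [|k IH].
    rewrite -plus_n_O; case: m Hex => [|m] Hex /=; first exact: epsilon_spec.
    by case: excluded_middle_informative => //= Hex'; exact: epsilon_spec.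
  rewrite -plus_n_Sm /=; case: excluded_middle_informative => //= Hex'.
  by apply: (decs _ (S k)); rewrite -plus_n_Sm; exact: epsilon_spec.
exists (fun i => pick i i) => m.
apply: U_mono2 (HA m) (U_ge m) => i Hex mi.
have E : (m + Nat.sub i m)%coq_nat = i by move: mi; clear; lia.
by rewrite -{3}E; exact: Hpick.
Qed.

Context {n : nat}.

Lemma approxV_refl (z : HV n) : approxV U z z.
Proof. by move=> eps e0; apply: U_true => i; rewrite vnorm_sub_refl. Qed.

Lemma standard_partV (z : HV n) : boundedV U z -> exists x, approxV U z (cstV x).
Proof.
case=> M HM.
have Hk k : exists x, approxC U (fun i => z i k) (cstC x).
  by apply: standard_part; exists M; apply: U_mono HM => i; exact.
pose x : Vec n := fun k => epsilon (inhabits (RtoC 0)) (fun x => approxC U (fun i => z i k) (cstC x)).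
have Hx k : approxC U (fun i => z i k) (cstC (x k)).
  by apply: (epsilon_spec (inhabits (RtoC 0)) (fun x => approxC U (fun i => z i k) (cstC x))); exact: Hk.
exists x => eps e0.
have n0 : 0 <= INR n := pos_INR n.
have e1 : 0 < eps / (INR n + 1) by apply: Rdiv_lt_0_compat; lra.
have all (l : seq 'I_n) : U (fun i => forall k, k \in l -> Cmod (z i k - x k) < eps / (INR n + 1)).
  elim: l => [|k l IH]; first by apply: U_true.
  apply: U_mono2 IH (Hx k _ e1) => i A B j; rewrite in_cons => /orP [/eqP -> //|]; exact: A.
apply: U_mono (all (enum 'I_n)) => i A.
apply: (Rle_lt_trans _ (INR n * (eps / (INR n + 1)))).
  by apply: vnorm_le_sum => k; apply: Rlt_le; apply: A; rewrite mem_enum.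
have E : (INR n + 1) * (eps / (INR n + 1)) = eps by field; lra.
rewrite -[X in _ < X]E.
by apply: Rmult_lt_compat_r; lra.
Qed.

Lemma approxC_vdot (c : nat -> Vec n) (d h : Vec n) :
  (forall k, approxC U (fun i => c i k) (cstC (d k))) ->
  approxC U (fun i => vdot (c i) h) (cstC (vdot d h)).
Proof.
move=> H; rewrite /vdot; elim: (enum 'I_n) => [|k l IH] /=; first exact: approxC_refl.
apply: approxC_plus IH.
have := approxC_scal (h k) (H k) => E eps e0; apply: U_mono (E eps e0) => i.
by rewrite /cstC !(Cmult_comm (h k)).
Qed.

End Ultrafilter.

(** * Limits of bounded families of holomorphic functions *)

Section Families.
Context {U : (nat -> Prop) -> Prop} (HU : nonprincipal_ultrafilter U) {n : nat}.
Implicit Types (F : nat -> Vec n -> C) (G f : Vec n -> C) (x z w h c : Vec n).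

(** Cauchy's estimates lose the boundary of a ball. Asking for bounds on smaller balls only, each
    with its own [M], makes the notion stable under derivation with the same [r]. *)
Definition ufam F x (r : R) : Prop :=
  forall r', r' < r -> exists M, U (fun i => bhol x r' M (F i)).

Definition ulim F G x (r : R) : Prop :=
  forall z, vnorm (vsub z x) < r -> approxC U (hev F (cstV z)) (cstC (G z)).

Lemma ufam_at F x (r : R) (z : HV n) (s : R) : ufam F x r -> s < r ->
  U (fun i => vnorm (vsub (z i) x) <= s) ->
  exists M, U (fun i => bhol (z i) ((r - s) / 2) M (F i)).
Proof.
(* Balls of radius [(r - s) / 2] about points within [s] of [x] stay within [(r + s) / 2 < r]. *)
move=> H sr Hz; have [M HM] := H ((r + s) / 2) ltac:(lra).
exists M; apply: (U_mono2 HU) Hz HM => i zs.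
by apply: bhol_sub; lra.
Qed.

Lemma ufam_at_cst F x (r : R) z : ufam F x r -> vnorm (vsub z x) < r ->
  exists M, U (fun i => bhol z ((r - vnorm (vsub z x)) / 2) M (F i)).
Proof.
move=> H Hz; apply: (ufam_at (z := cstV z) H Hz).
by apply: (U_true HU) => i; rewrite /cstV; lra.
Qed.

(** Pointwise convergence is enough: the quadratic remainder has the same constant for almost all
    [i], so it passes to the limit for each [h] separately. *)
Lemma ulim_derive F G x (r : R) z : ufam F x r -> ulim F G x r -> vnorm (vsub z x) < r ->
  is_grad G z (grad G z) /\
  forall k, approxC U (fun i => pderiv k (F i) z) (cstC (pderiv k G z)).
Proof.
move=> HF HG Hz; have [M HM] := ufam_at_cst HF Hz.
move: HM; set s := (_ / 2) => HM.
have s0 : 0 < s by rewrite /s; lra.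
have Hk k : exists y, approxC U (fun i => pderiv k (F i) z) (cstC y).
  apply: (standard_part HU); exists (8 * M / s); apply: (U_mono HU) HM => i.
  exact: bhol_pderiv.
pose c : Vec n := fun k =>
  epsilon (inhabits (RtoC 0)) (fun y => approxC U (fun i => pderiv k (F i) z) (cstC y)).
have Hc k : approxC U (fun i => pderiv k (F i) z) (cstC (c k)).
  by apply: (epsilon_spec (inhabits (RtoC 0)) (fun y => approxC U (fun i => pderiv k (F i) z) (cstC y))); exact: Hk.
have Gc : is_grad G z c.
  apply: (quadratic_is_grad (K := 2048 * M / s ^ 2) (d := s / 4)); first lra.
  move=> h Hh.
  (* Differences are written with [-1] to fit [approxC_plus] and [approxC_scal]. *)
  apply: (approxC_le HU (u := fun i => (F i (vadd z h) + (RtoC (-1) * F i z +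
      RtoC (-1) * vdot (grad (F i) z) h))%C)); last first.
    apply: (U_mono HU) HM => i Hi.
    have -> : (F i (vadd z h) + (RtoC (-1) * F i z + RtoC (-1) * vdot (grad (F i) z) h) =
      F i (vadd z h) - F i z - vdot (grad (F i) z) h)%C.
      by apply: injective_projections => /=; ring.
    exact: bhol_second_order.
  have -> : cstC (G (vadd z h) - G z - vdot c h) =
    fun i => (cstC (G (vadd z h)) i + (RtoC (-1) * cstC (G z) i + RtoC (-1) * cstC (vdot c h) i))%C.
    by rewrite /cstC; apply: functional_extensionality => i; apply: injective_projections => /=; ring.
  apply: (approxC_plus HU).
    apply: HG; apply: Rle_lt_trans (vnorm_sub_triangle _ z _) _.
    by rewrite vsub_add /s in Hh *; lra.
  apply: (approxC_plus HU); apply: (approxC_scal HU); first exact: HG.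
  exact: (approxC_vdot HU).
rewrite -(is_grad_eq Gc); split=> // k.
by have -> : pderiv k G z = c k by rewrite (is_grad_eq Gc).
Qed.

Lemma vdot_quotient (a : C) c c' h :
  vdot (vscal a (vsub c c')) h = (a * (vdot c h - vdot c' h))%C.
Proof.
rewrite /vdot; elim: (enum 'I_n) => [|k l IH] /=; first by ring.
by rewrite IH /vscal /vsub; ring.
Qed.

Lemma is_grad_quotient f (a : C) v w c c' : is_grad f (vadd w v) c -> is_grad f w c' ->
  is_grad (fun w => a * (f (vadd w v) - f w))%C w (vscal a (vsub c c')).
Proof.
move=> H H' eps e0; have a0 := Cmod_ge_0 a.
have e1 : 0 < eps / (2 * Cmod a + 1) by apply: Rdiv_lt_0_compat; lra.
have [d [d0 Hd]] := H _ e1; have [d' [d0' Hd']] := H' _ e1.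
exists (Rmin d d'); split; first exact: Rmin_pos.
move=> h Hh.
have := Hd h (Rlt_le_trans _ _ _ Hh (Rmin_l _ _)).
have := Hd' h (Rlt_le_trans _ _ _ Hh (Rmin_r _ _)).
rewrite vdot_quotient.
have -> : vadd (vadd w h) v = vadd (vadd w v) h.
  by apply: functional_extensionality => k; rewrite /vadd; ring.
set A := (_ - _ - _)%C; set B := (_ - _ - _)%C => HA HB.
have -> : (a * (f (vadd (vadd w v) h) - f (vadd w h)) - a * (f (vadd w v) - f w) -
  a * (vdot c h - vdot c' h) = a * (B + - A))%C by rewrite /A /B; ring.
rewrite Cmod_mult.
have h0 := vnorm_ge0 h.
have T := Cmod_triangle B (- A); rewrite Cmod_opp in T.
apply: (Rle_trans _ (Cmod a * (2 * (eps / (2 * Cmod a + 1) * vnorm h)))).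
  by apply: Rmult_le_compat_l; lra.
have E : eps * vnorm h = (2 * Cmod a + 1) * (eps / (2 * Cmod a + 1) * vnorm h) by field; lra.
rewrite E; have := Rmult_le_pos _ _ (Rlt_le _ _ e1) h0; lra.
Qed.

Lemma U_inv (d : R) : 0 < d -> U (fun i => / INR (S i) < d).
Proof.
move=> d0; have [N [N0 HN]] := archimed_cor1 d d0.
apply: (U_mono HU) (U_ge HU N) => i Ni; apply: Rle_lt_trans N0.
apply: Rinv_le_contravar; first exact: lt_0_INR.
by apply: le_INR; lia.
Qed.

(* The difference quotients with increment [1 / (i + 1)] are a bounded family
   of holomorphic functions whose limit along [U] is the partial derivative. *)
Lemma pderiv_cdiff f x (r M : R) k : 0 < r -> bhol x r M f -> cdiff (pderiv k f) x.
Proof.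
move=> r0 H.
pose t i := / INR (S i).
have t0 i : 0 < t i by apply: Rinv_0_lt_compat; apply: lt_0_INR; lia.
pose Q i w := (RtoC (/ t i) * (f (vadd w (vscal (RtoC (t i)) (ebasis k))) - f w))%C.
have ve : vnorm (ebasis k : Vec n) <= 1 := vnorm_ebasis k.
have M0 : 0 <= M.
  have [_] := H x ltac:(rewrite vnorm_sub_refl; lra).
  by have := Cmod_ge_0 (f x); lra.
have tk i : vnorm (vscal (RtoC (t i)) (ebasis k) : Vec n) <= t i.
  have := t0 i; rewrite vnorm_scal Cmod_R => ti; rewrite Rabs_pos_eq; last lra.
  by rewrite -[X in _ <= X]Rmult_1_r; apply: Rmult_le_compat_l; lra.
(* With [w] within [r / 4] of [x], the ball of radius [r / 2] about [w] stays in the given one, and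
   increments below [r / 4] meet the condition of [bhol_lipschitz] there; this gives
   [32 * M / (r / 2)]. *)
have HQ : ufam Q x (r / 4).
  move=> r' Hr'; exists (64 * M / r).
  apply: (U_mono HU) (U_inv (d := r / 4) ltac:(lra)) => i; rewrite -/(t i) => ti w Hw.
  have ti0 := t0 i; have tki := tk i.
  set v := vscal (RtoC (t i)) (ebasis k) in tki *.
  have Hwv : vnorm (vsub (vadd w v) x) < r.
    by apply: Rle_lt_trans (vnorm_sub_triangle _ w _) _; rewrite vsub_add; lra.
  have [D1 _] := H _ Hwv; have [D2 _] := H w ltac:(lra).
  split.
    by eexists; apply: is_grad_quotient; apply: cdiff_grad; [exact: D1 | exact: D2].
  rewrite /Q -/v Cmod_mult Cmod_R Rabs_pos_eq; last by apply: Rlt_le; apply: Rinv_0_lt_compat.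
  have Hb : bhol w (r / 2) M f by apply: bhol_sub H; lra.
  have := @bhol_lipschitz n w (r / 2) M f (vadd w v) ltac:(lra) Hb; rewrite vsub_add => L.
  have {}L := L ltac:(lra).
  have L2 : 32 * M / (r / 2) * vnorm v <= 64 * M / r * t i.
    have -> : 32 * M / (r / 2) = 64 * M / r by field; lra.
    apply: Rmult_le_compat_l => //; apply: Rmult_le_pos; first lra.
    by apply: Rlt_le; apply: Rinv_0_lt_compat.
  have -> : 64 * M / r = / t i * (64 * M / r * t i) by field; lra.
  apply: Rmult_le_compat_l; first by apply: Rlt_le; apply: Rinv_0_lt_compat.
  lra.
have HL : ulim Q (pderiv k f) x (r / 4).
  move=> w Hw eps e0; have [D _] := H w ltac:(lra).
  have [d [d0 Hd]] := is_grad_pderiv k (cdiff_grad D) e0.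
  apply: (U_mono HU) (U_inv d0) => i; rewrite -/(t i) => ti; have ti0 := t0 i.
  rewrite /hev /cstV /cstC /Q.
  have tn : RtoC (t i) <> 0%C by move=> /RtoC_inj; lra.
  have := Hd _ tn; rewrite Cmod_R Rabs_pos_eq; last lra.
  move=> /(_ ti); rewrite /grad /Cdiv RtoC_inv; last lra.
  by rewrite (Cmult_comm (/ _)).
exists (grad (pderiv k f) x).
by have [] := ulim_derive HQ HL (z := x) ltac:(rewrite vnorm_sub_refl; lra).
Qed.

Lemma ufam_pderiv F x (r : R) k : ufam F x r -> ufam (fun i => pderiv k (F i)) x r.
Proof.
move=> H r' Hr'; have [M HM] := H ((r' + r) / 2) ltac:(lra).
exists (8 * M / ((r - r') / 2)); apply: (U_mono HU) HM => i Hi z Hz.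
have Hb : bhol z ((r - r') / 2) M (F i) by apply: bhol_sub Hi; lra.
by split; [apply: pderiv_cdiff Hb; lra | apply: bhol_pderiv Hb; lra].
Qed.

(** Both conclusions are carried together because each further derivation by [ulim_derive] consumes
    both. *)
Lemma ulim_dalpha F G x (r : R) (alpha : 'I_n -> nat) : ufam F x r -> ulim F G x r ->
  ufam (fun i => dalpha alpha (F i)) x r /\
  ulim (fun i => dalpha alpha (F i)) (dalpha alpha G) x r.
Proof.
move=> HF HG; rewrite /dalpha; elim: (enum 'I_n) => [//|k l [IF IG]] /=.
elim: (alpha k) => [//|m [JF JG]] /=.
split; first exact: ufam_pderiv.
by move=> z Hz; have [_] := ulim_derive JF JG Hz; apply.
Qed.

(** Around [z i], almost all members share one standard Lipschitz constant. *)
Lemma ufam_S_continuous F x (r s : R) (z : HV n) : ufam F x r -> s < r ->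
  U (fun i => vnorm (vsub (z i) x) <= s) -> S_continuous_at U F z.
Proof.
move=> HF sr Hz w wz eps e0; have [M HM] := ufam_at HF sr Hz.
move: HM; set t := _ / 2 => HM.
have t0 : 0 < t by rewrite /t; lra.
pose K := Rabs (32 * M / t) + 1.
have K0 : 0 < K by rewrite /K; have := Rabs_pos (32 * M / t); lra.
have eK : 0 < eps / K by exact: Rdiv_lt_0_compat.
have m0 : 0 < Rmin (t / 2) (eps / K) by apply: Rmin_pos; lra.
apply: (U_mono2 HU) HM (wz _ m0) => i Hb Hw.
have W1 := Rlt_le_trans _ _ _ Hw (Rmin_l _ _).
have W2 := Rlt_le_trans _ _ _ Hw (Rmin_r _ _).
have L := bhol_lipschitz t0 Hb (Rlt_le _ _ W1).
rewrite /hev; apply: Rle_lt_trans L _.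
have v0 := vnorm_ge0 (vsub (w i) (z i)).
apply: (Rle_lt_trans _ (K * vnorm (vsub (w i) (z i)))).
  by apply: Rmult_le_compat_r => //; rewrite /K; have := Rle_abs (32 * M / t); lra.
have -> : eps = K * (eps / K) by field; lra.
exact: Rmult_lt_compat_l.
Qed.

End Families.

(** * Isolated zeros *)

Lemma vdot1 (c h : Vec 1) : vdot c h = (c ord0 * h ord0)%C.
Proof.
have {1}-> : h = vscal (h ord0) (ebasis ord0).
  by apply: functional_extensionality => k; rewrite (ord1 k) /vscal /ebasis eqxx; ring.
by rewrite vdot_scal vdot_ebasis Cmult_comm.
Qed.

(* A function of one variable is a function on [Vec 1], to which [pderiv_cdiff]
   applies; this is where [U] comes in. *)
Lemma cder_deriv (U : (nat -> Prop) -> Prop) (HU : nonprincipal_ultrafilter U)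
  (r : R) (f f' : C -> C) (z : C) :
  hol r f f' -> Cmod z < r -> exists l, cder f' z l.
Proof.
move=> H Hz.
pose F (v : Vec 1) := f (v ord0).
have gradF (v : Vec 1) : Cmod (v ord0) < r -> is_grad F v (fun _ => f' (v ord0)).
  move=> Hv eps e0; have [d [d0 Hd]] := H _ Hv eps e0.
  exists d; split=> // h Hh; rewrite vdot1 /F /vadd.
  have hh := Cmod_le_vnorm h ord0.
  apply: Rle_trans (Hd _ (Rle_lt_trans _ _ _ hh Hh)) _.
  by apply: Rmult_le_compat_l; lra.
have pF (v : Vec 1) : Cmod (v ord0) < r -> pderiv ord0 F v = f' (v ord0).
  by move=> Hv; rewrite (pderiv_eq (is_grad_pderiv ord0 (gradF _ Hv))).
(* [hol] provides no bound; continuity at [z] supplies one on a small disc. *)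
have [d [d0 Hd]] := cder_cont (H _ Hz) Rlt_0_1.
pose s := Rmin d (r - Cmod z).
have s0 : 0 < s by apply: Rmin_pos; lra.
have s1 : s <= d := Rmin_l _ _.
have s2 : s <= r - Cmod z := Rmin_r _ _.
pose x : Vec 1 := fun _ => z.
have in_r w : Cmod (w - z) < s -> Cmod w < r.
  move=> Hw; have -> : w = (w - z + z)%C by ring.
  by apply: Rle_lt_trans (Cmod_triangle _ _) _; lra.
have B : bhol x s (Cmod (f z) + 1) F.
  move=> v Hv; have := Cmod_le_vnorm (vsub v x) ord0; rewrite /vsub /x => Hv0.
  have Hvz : Cmod (v ord0 - z) < s by apply: Rle_lt_trans Hv0 Hv.
  split; first by eexists; apply: gradF; exact: in_r.
  have := Hd _ (Rlt_le_trans _ _ _ Hvz s1).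
  have E : F v = ((f (v ord0) - f z) + f z)%C by rewrite /F; ring.
  by rewrite E => D; apply: Rle_trans (Cmod_triangle _ _) _; lra.
have [c Hc] := pderiv_cdiff HU ord0 s0 B.
have Hc' : is_grad (pderiv ord0 F) (vadd x (vscal 0%C (ebasis ord0))) c by rewrite vadd0.
have D := is_grad_line Hc'.
set l := vdot _ _ in D.
exists l.
have D2 : cder (fun u => pderiv ord0 F (vadd x (vscal (- z + u)%C (ebasis ord0)))) z l.
  apply: (cder_shift (f := fun u => pderiv ord0 F (vadd x (vscal u (ebasis ord0))))).
  by have -> : (- z + z = 0)%C by ring.
apply: cder_ext s0 _ D2 => w Hw.
have E : vadd x (vscal (- z + w)%C (ebasis ord0)) ord0 = w.
  by rewrite /vadd /x /vscal /ebasis eqxx; ring.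
by rewrite pF E //; exact: in_r.
Qed.

(** Little-o of [t^k] at 0: for holomorphic [f], a zero of order greater than [k]. *)
Definition flat (f : C -> C) (k : nat) : Prop :=
  forall eps, 0 < eps -> exists delta, 0 < delta /\
    forall t, Cmod t < delta -> Cmod (f t) <= eps * Cmod t ^ k.

Fixpoint cpow_inv (t : C) (k : nat) : C :=
  match k with O => 1%C | S k => (/ t * cpow_inv t k)%C end.

Lemma Cmod_cpow_inv (t : C) (k : nat) : t <> 0%C -> Cmod (cpow_inv t k) = / Cmod t ^ k.
Proof.
move=> t0; have m0 : 0 < Cmod t by apply/Cmod_gt_0.
elim: k => [|k IH] /=; first by rewrite Cmod_1 Rinv_1.
by rewrite Cmod_mult IH Cmod_inv // Rinv_mult.
Qed.

Lemma cder_cpow_inv (t : C) (k : nat) : t <> 0%C ->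
  exists l, cder (fun t => cpow_inv t k) t l.
Proof.
move=> t0; elim: k => [|k [l IH]] /=; first by eexists; exact: cder_const.
by eexists; apply: cder_mult IH; exact: cder_inv.
Qed.

(* When [f 0 = 0], the junk value of [/ 0] is harmless: [quot f k 0 = 0]. *)
Definition quot (f : C -> C) (k : nat) (t : C) : C := (f t * cpow_inv t k)%C.

Lemma Cmod_quot (f : C -> C) (k : nat) (t : C) : t <> 0%C ->
  Cmod (quot f k t) = Cmod (f t) / Cmod t ^ k.
Proof. by move=> t0; rewrite /quot Cmod_mult Cmod_cpow_inv. Qed.

Lemma quot_small (f : C -> C) (k j : nat) : f 0%C = 0%C -> flat f (k + j)%coq_nat ->
  flat (quot f k) j.
Proof.
move=> f0 H eps e0; have [d [d0 Hd]] := H eps e0.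
exists d; split=> // t Ht; have t0 := Cmod_ge_0 t.
case: (excluded_middle_informative (t = 0%C)) => [->|tn].
  rewrite /quot f0 Cmult_0_l Cmod_0; apply: Rmult_le_pos; first lra.
  by apply: pow_le; lra.
have m0 : 0 < Cmod t by apply/Cmod_gt_0.
rewrite Cmod_quot //; apply/Rle_div_l; first exact: pow_lt.
by apply: Rle_trans (Hd t Ht) _; rewrite pow_add; right; ring.
Qed.

Lemma cder_quot_off0 (r : R) (f f' : C -> C) (k : nat) (t : C) : hol r f f' ->
  Cmod t < r -> t <> 0%C -> exists l, cder (quot f k) t l.
Proof.
move=> H Ht t0; have [l Hl] := cder_cpow_inv k t0.
by eexists; apply: cder_mult; [exact: H | exact: Hl].
Qed.

Lemma flat1_cder (q : C -> C) : q 0%C = 0%C -> flat q 1 -> cder q 0%C 0%C.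
Proof.
move=> q0 H eps e0; have [d [d0 Hd]] := H eps e0.
exists d; split=> // h Hh; rewrite Cplus_0_l q0.
have -> : (q h - 0 - 0 * h = q h)%C by ring.
by have := Hd h Hh; rewrite pow_1.
Qed.

(* The points of the circle of centre [z] and radius [3 |z|] have modulus at
   least [2 |z|], so [circle_bound] for [quot f k] gains a factor [2 ^ k]. *)
Lemma all_flat_zero (r M : R) (f f' : C -> C) (z : C) : hol r f f' ->
  (forall t, Cmod t < r -> Cmod (f t) <= M) -> f 0%C = 0%C ->
  (forall k, flat f k) -> Cmod z < r / 4 -> f z = 0%C.
Proof.
move=> H HM f0 Hf Hz.
case: (excluded_middle_informative (z = 0%C)) => [-> //|zn].
have m0 : 0 < Cmod z by apply/Cmod_gt_0.
have B k : Cmod (f z) <= 2 * M * (/ 2) ^ k.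
  have q0 : quot f k 0%C = 0%C by rewrite /quot f0 Cmult_0_l.
  (* At 0, flatness of order [k + 1] makes the quotient [o(t)], so its derivative there is 0. *)
  have dq t : Cmod t < r -> exists l, cder (quot f k) t l.
    move=> Ht; case: (excluded_middle_informative (t = 0%C)) => [->|tn].
      by exists 0%C; apply: flat1_cder => //; apply: quot_small.
    exact: cder_quot_off0 H Ht tn.
  have in_r u : Cmod u < r - Cmod z -> Cmod (z + u) < r.
    by move=> Hu; apply: Rle_lt_trans (Cmod_triangle _ _) _; lra.
  have dqz u : Cmod u < r - Cmod z -> exists l, cder (fun u => quot f k (z + u)%C) u l.
    by move=> /in_r /dq [l Hl]; exists l; exact: cder_shift.
  (* The circle fits in the disc of radius [r - |z|] because [|z| < r / 4]. *)
  have := @circle_bound (fun u => quot f k (z + u)%C) (quot f k z) (3 * Cmod z) (r - Cmod z)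
    (M / (2 * Cmod z) ^ k) ltac:(lra).
  move=> CB; have {CB} : Cmod (quot f k z) <= 2 * (M / (2 * Cmod z) ^ k).
    apply: CB.
    - by move=> u [_ Hu]; exact: dqz.
    - move=> eps e0; have [l /cder_cont Hl] := dqz 0%C ltac:(rewrite Cmod_0; lra).
      have [d [d0 Hd]] := Hl eps e0; exists d; split=> // u [_ Hu]; apply: Rlt_le.
      have := Hd u; rewrite Cplus_0_r; apply.
      by have -> : (u - 0 = u)%C by ring.
    - move=> u Hu.
      have zu : 2 * Cmod z <= Cmod (z + u).
        have := Cmod_triangle (z + u) (- z); rewrite Cmod_opp.
        have -> : (z + u + - z = u)%C by ring.
        lra.
      have zun : (z + u)%C <> 0%C by apply/Cmod_gt_0; lra.
      rewrite Cmod_quot //; apply: Rmult_le_compat; first exact: Cmod_ge_0.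
      + by apply: Rlt_le; apply: Rinv_0_lt_compat; apply: pow_lt; lra.
      + by apply: HM; apply: in_r; lra.
      + apply: Rinv_le_contravar; first by apply: pow_lt; lra.
        by apply: pow_incr; lra.
  rewrite Cmod_quot // Rpow_mult_distr pow_inv.
  have p1 := pow_lt _ k m0; have p2 := pow_lt 2 k ltac:(lra).
  move=> /(Rmult_le_compat_r _ _ _ (Rlt_le _ _ p1)).
  have -> : Cmod (f z) / Cmod z ^ k * Cmod z ^ k = Cmod (f z) by field; lra.
  have -> : 2 * (M / (2 ^ k * Cmod z ^ k)) * Cmod z ^ k = 2 * M * / 2 ^ k by field; lra.
  by [].
apply: Cmod_eq_0; apply: Rle_antisym; last exact: Cmod_ge_0.
apply: le_epsilon => eps e0; rewrite Rplus_0_l.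
have M1 : 0 < 2 * Rabs M + 1 by have := Rabs_pos M; lra.
have [N HN] := pow_lt_1_zero (/ 2) ltac:(rewrite Rabs_pos_eq; lra) (eps / (2 * Rabs M + 1))
  ltac:(exact: Rdiv_lt_0_compat).
have := HN N (Nat.le_refl _); have p0 := pow_le (/ 2) N ltac:(lra).
rewrite Rabs_pos_eq // => Hp.
apply: Rle_trans (B N) _.
apply: (Rle_trans _ ((2 * Rabs M + 1) * (/ 2) ^ N)).
  by apply: Rmult_le_compat_r => //; have := Rle_abs M; lra.
have -> : eps = (2 * Rabs M + 1) * (eps / (2 * Rabs M + 1)) by field; lra.
by apply: Rmult_le_compat_l; lra.
Qed.

(** If [k] is the last order to which [f] is flat, then [w = t * f / t^k] behaves like a nonzero
    multiple of [t^2], so 0 is isolated among the zeros. If [f] is flat to every order,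
    [all_flat_zero] applies. *)
Lemma zero_dichotomy (U : (nat -> Prop) -> Prop) (HU : nonprincipal_ultrafilter U)
  (r M : R) (f f' : C -> C) : 0 < r -> hol r f f' ->
  (forall t, Cmod t < r -> Cmod (f t) <= M) -> f 0%C = 0%C ->
  (exists d, 0 < d /\ forall t, 0 < Cmod t < d -> f t <> 0%C) \/
  (forall t, Cmod t < r / 4 -> f t = 0%C).
Proof.
move=> r0 H HM f0.
case: (classic (forall k, flat f k)) => [all|/not_all_ex_not [k0 nk0]].
  by right=> t; apply: all_flat_zero H HM f0 all.
left.
have c0 : Cmod 0 < r by rewrite Cmod_0.
have fl0 : flat f 0.
  move=> eps e0; have [d [d0 Hd]] := cder_cont (H _ c0) e0.
  exists d; split=> // t Ht; rewrite pow_O Rmult_1_r; apply: Rlt_le.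
  have := Hd t; rewrite f0.
  have -> : (t - 0 = t)%C by ring.
  have -> : (f t - 0 = f t)%C by ring.
  by apply.
have [k [fk nfk]] : exists k, flat f k /\ ~ flat f (S k).
  apply: NNPP => no; apply: nk0; elim: k0 => [//|k IH].
  by apply: NNPP => nk; apply: no; exists k.
(* The quotient alone is merely [o(1)] at 0, which yields no derivative; the extra factor [t] makes
   it [o(t)], with derivative 0. *)
pose w t := (t * quot f k t)%C.
have w0 : w 0%C = 0%C by rewrite /w Cmult_0_l.
have fq : flat (quot f k) 0 by apply: quot_small; rewrite // -plus_n_O.
have w1 : flat w 1.
  move=> eps e0; have [d [d0 Hd]] := fq eps e0; exists d; split=> // t Ht.
  have := Hd t Ht; rewrite pow_1 pow_O Rmult_1_r /w Cmod_mult Rmult_comm => A.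
  by apply: Rmult_le_compat_r => //; exact: Cmod_ge_0.
have dw t : Cmod t < r -> exists l, cder w t l.
  move=> Ht; case: (excluded_middle_informative (t = 0%C)) => [->|tn].
    by exists 0%C; exact: flat1_cder.
  have [l Hl] := cder_quot_off0 k H Ht tn.
  by eexists; apply: cder_mult Hl; exact: cder_id.
pose w' t := epsilon (inhabits (RtoC 0)) (fun l => cder w t l).
have Hw : hol r w w' by move=> t /dw Hex; exact: (epsilon_spec (inhabits (RtoC 0)) (fun l => cder w t l) Hex).
(* [w'] was picked by [epsilon]; uniqueness of the derivative identifies its value at 0. *)
have w'0 : w' 0%C = 0%C.
  apply: Csub_eq0; apply: Cmod_eq_0; apply: Rle_antisym; last exact: Cmod_ge_0.
  apply: le_epsilon => eps e0; rewrite Rplus_0_l.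
  have [d [d0 Hd]] := Hw _ c0 (eps / 2) ltac:(lra).
  have [e [f1 He]] := flat1_cder w0 w1 (eps := eps / 2) ltac:(lra).
  have m0 : 0 < Rmin d e by exact: Rmin_pos.
  pose h := RtoC (Rmin d e / 2).
  have hm : Cmod h = Rmin d e / 2 by rewrite Cmod_R Rabs_pos_eq; lra.
  have Hh : Cmod h < Rmin d e by lra.
  have A := Hd h (Rlt_le_trans _ _ _ Hh (Rmin_l _ _)).
  have B := He h (Rlt_le_trans _ _ _ Hh (Rmin_r _ _)).
  have T := Cmod_triangle (w (0 + h)%C - w 0%C - 0 * h) (- (w (0 + h)%C - w 0%C - w' 0%C * h)).
  rewrite Cmod_opp in T.
  have E : (w (0 + h) - w 0 - 0 * h + - (w (0 + h) - w 0 - w' 0 * h) = (w' 0 - 0) * h)%C by ring.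
  rewrite E Cmod_mult in T.
  apply: (Rmult_le_reg_r (Cmod h)); lra.
have [beta Hb] := cder_deriv HU Hw c0.
(* Second-order expansion at 0: the derivative of [w - beta / 2 * u^2] is [w' - beta * u], which is
   [o(u)], and [cmvt] integrates this. *)
have Q eps : 0 < eps -> exists d, 0 < d /\ forall t, Cmod t < d ->
    Cmod (w t - beta / 2 * t * t) <= 2 * (eps * Cmod t * Cmod t).
  move=> e0; have [d [d0 Hd]] := Hb eps e0.
  exists (Rmin d r); split; first exact: Rmin_pos.
  move=> t Ht.
  have t1 := Rlt_le_trans _ _ _ Ht (Rmin_l _ _).
  have t2 := Rlt_le_trans _ _ _ Ht (Rmin_r _ _).
  have := @cmvt (fun u => w u + - (beta / 2) * (u * u))%C
    (fun u => w' u + (0 * (u * u) + - (beta / 2) * (1 * u + u * 1)))%C t (eps * Cmod t).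
  have two : RtoC 2 <> 0%C by move=> /RtoC_inj; lra.
  rewrite w0; have -> : (w t + - (beta / 2) * (t * t) - (0 + - (beta / 2) * (0 * 0)) =
    w t - beta / 2 * t * t)%C by field.
  apply=> s Hs.
  have Hst : Cmod (RtoC s * t) <= Cmod t.
    rewrite Cmod_mult Cmod_R Rabs_pos_eq; last lra.
    rewrite -[X in _ <= X]Rmult_1_l; apply: Rmult_le_compat_r; [exact: Cmod_ge_0 | lra].
  split.
    apply: cder_plus; first by apply: Hw; lra.
    apply: (cder_mult (cder_const _ _)); exact: (cder_mult (cder_id _) (cder_id _)).
  have := Hd (RtoC s * t)%C ltac:(lra).
  rewrite Cplus_0_l w'0.
  have -> : (w' (RtoC s * t) - 0 - beta * (RtoC s * t) = w' (RtoC s * t) +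
    (0 * (RtoC s * t * (RtoC s * t)) + - (beta / 2) * (1 * (RtoC s * t) + RtoC s * t * 1)))%C by field.
  move=> A; apply: Rle_trans A _; apply: Rmult_le_compat_l; lra.
(* Otherwise [w = o(t^2)], that is [f = o(t^(k+1))], against the choice of [k]. *)
have b0 : beta <> 0%C.
  move=> b0; apply: nfk => eps e0.
  have [d [d0 Hd]] := Q (eps / 2) ltac:(lra).
  exists d; split=> // t Ht; have := Hd t Ht.
  have -> : (w t - beta / 2 * t * t = w t)%C.
    have two : RtoC 2 <> 0%C by move=> /RtoC_inj; lra.
    by rewrite b0; field.
  case: (excluded_middle_informative (t = 0%C)) => [->|tn].
    by rewrite f0 Cmod_0 => _ /=; lra.
  have m0 : 0 < Cmod t by apply/Cmod_gt_0.
  have pk := pow_lt _ k m0.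
  rewrite /w Cmod_mult Cmod_quot // => /(Rmult_le_compat_r (Cmod t ^ k / Cmod t) _ _
    (Rlt_le _ _ (Rdiv_lt_0_compat _ _ pk m0))).
  have -> : Cmod t * (Cmod (f t) / Cmod t ^ k) * (Cmod t ^ k / Cmod t) = Cmod (f t) by field; lra.
  have -> : 2 * (eps / 2 * Cmod t * Cmod t) * (Cmod t ^ k / Cmod t) = eps * Cmod t ^ S k.
    by rewrite /=; field; lra.
  by [].
have mb : 0 < Cmod beta by apply/Cmod_gt_0.
(* The error is then [|beta| |t|^2 / 4], less than the main term [|beta| |t|^2 / 2]. *)
have [d [d0 Hd]] := Q (Cmod beta / 8) ltac:(lra).
exists d; split=> // t [t0 td] ft.
have := Hd t td.
have -> : (w t - beta / 2 * t * t = - (beta / 2 * t * t))%C.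
  by rewrite /w /quot ft; ring.
rewrite Cmod_opp !Cmod_mult Cmod_inv; last by move=> /RtoC_inj; lra.
rewrite Cmod_R Rabs_pos_eq; last lra.
have := Rmult_lt_0_compat _ _ (Rmult_lt_0_compat _ _ mb t0) t0; lra.
Qed.

(** Identity theorem along [[0, 1]]: if 0 is not isolated, [f] vanishes near 0, and [zero_dichotomy]
    spreads this over overlapping discs as far as 1. *)
Lemma isolated_zero (U : (nat -> Prop) -> Prop) (HU : nonprincipal_ultrafilter U)
  (r M : R) (f f' : C -> C) : 1 < r -> hol r f f' ->
  (forall t, Cmod t < r -> Cmod (f t) <= M) -> f 0%C = 0%C -> f 1%C <> 0%C ->
  exists d, 0 < d /\ forall t, 0 < Cmod t < d -> f t <> 0%C.
Proof.
move=> r1 H HM f0 f1; apply: NNPP => no.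
(* Discs of radius [s] centred on the segment stay in the domain. Steps shorter than [s / 8] keep
   the next centre, with a disc of radius [s / 8], inside the previous disc of zeros, of radius
   [s / 4]. *)
pose s := r - 1.
have [N [HN N0]] := archimed_cor1 (s / 8) ltac:(rewrite /s; lra).
have n0 : 0 < INR N by exact: lt_0_INR.
have nn : 0 < / INR N by exact: Rinv_0_lt_compat.
pose p j := RtoC (INR j * / INR N).
have pS j : p (S j) = (p j + RtoC (/ INR N))%C.
  by rewrite /p S_INR -RtoC_plus; congr RtoC; ring.
have step j : (j <= N)%coq_nat -> forall t, Cmod t < s / 4 -> f (p j + t)%C = 0%C.
  elim: j => [_ t Ht|j IH jN t Ht].
    rewrite /p /= Rmult_0_l Cplus_0_l.
    case: (zero_dichotomy HU (ltac:(lra) : 0 < r) H HM f0) => // Z.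
    by apply: Z; rewrite /s in Ht; lra.
  have {}IH := IH ltac:(lia).
  have pj : Cmod (p (S j)) <= 1.
    rewrite /p Cmod_R Rabs_pos_eq; last by apply: Rmult_le_pos; [exact: pos_INR | lra].
    have := le_INR _ _ jN => A.
    by have := Rmult_le_compat_r _ _ _ (Rlt_le _ _ nn) A; rewrite Rinv_r; lra.
  have near u : Cmod u < s / 8 -> f (p (S j) + u)%C = 0%C.
    move=> Hu; rewrite pS -Cplus_assoc; apply: IH.
    apply: Rle_lt_trans (Cmod_triangle _ _) _; rewrite Cmod_R Rabs_pos_eq; lra.
  have Hs := @hol_shift r s f f' (p (S j)) ltac:(rewrite /s; lra) H.
  have Ms u : Cmod u < s -> Cmod (f (p (S j) + u)%C) <= M.
    by move=> Hu; apply: HM; apply: Rle_lt_trans (Cmod_triangle _ _) _; rewrite /s in Hu; lra.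
  have s0 : 0 < s by rewrite /s; lra.
  case: (zero_dichotomy HU s0 Hs Ms); [by apply: near; rewrite Cmod_0; lra | | exact].
  case=> d [d0 Hd]; pose u := Rmin (d / 2) (s / 16).
  have u0 : 0 < u by apply: Rmin_pos; lra.
  have u1 : u <= d / 2 := Rmin_l _ _.
  have u2 : u <= s / 16 := Rmin_r _ _.
  have mu : Cmod (RtoC u) = u by rewrite Cmod_R Rabs_pos_eq; lra.
  by case: (Hd (RtoC u) ltac:(rewrite mu; lra)); apply: near; rewrite mu; lra.
apply: f1; have := step N (Nat.le_refl _) 0%C ltac:(rewrite Cmod_0 /s; lra).
by rewrite Cplus_0_r /p Rinv_r //; lra.
Qed.

(** * Internal holomorphic functions bounded on a halo *)

Lemma inv_S_pos (m : nat) : 0 < / INR (S m).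
Proof. by apply: Rinv_0_lt_compat; apply: lt_0_INR; lia. Qed.

Lemma inv_S_dec (m : nat) : / INR (S (S m)) <= / INR (S m).
Proof. by apply: Rinv_le_contravar; [apply: lt_0_INR; lia | apply: le_INR; lia]. Qed.

Lemma inv_S_small (eps : R) : 0 < eps -> exists m, / INR (S m) < eps.
Proof.
move=> e0; have [N [N0 HN]] := archimed_cor1 eps e0.
by exists (Nat.pred N); have -> : S (Nat.pred N) = N by lia.
Qed.

Section Halo.
Context {U : (nat -> Prop) -> Prop} (HU : nonprincipal_ultrafilter U) {n : nat}.
Context (fs : nat -> Vec n -> C) (a : HV n).

Lemma halo_saturation (P : nat -> Vec n -> Prop) :
  (forall m, U (fun i => exists z, vnorm (vsub z (a i)) < / INR (S m) /\ P i z)) ->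
  exists z : HV n, approxV U z a /\ U (fun i => P i (z i)).
Proof.
move=> H.
have [zs Hz] := saturation HU (fun _ => RtoC 0 : C)
  (A := fun m i z => vnorm (vsub z (a i)) < / INR (S m) /\ P i z)
  (fun m i z => ltac:(case=> A B; split=> //; have := inv_S_dec m; lra)) H.
exists zs; split; last by apply: (U_mono HU) (Hz O) => i [].
move=> eps e0; have [m Hm] := inv_S_small e0.
by apply: (U_mono HU) (Hz m) => i [A _]; lra.
Qed.

(** If no radius [1 / (m + 1)] goes with the bound [m], saturation produces one point of the halo
    where the modulus exceeds every standard bound. *)
Lemma bounded_on_halo : (forall z, approxV U z a -> boundedC U (hev fs z)) ->
  exists d M, 0 < d /\ U (fun i => forall z, vnorm (vsub z (a i)) < d -> Cmod (fs i z) <= M).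
Proof.
move=> Hb; apply: NNPP => no.
have [zs Hz] := @saturation U HU (Vec n) (fun _ => RtoC 0)
  (fun m i z => vnorm (vsub z (a i)) < / INR (S m) /\ INR m < Cmod (fs i z))
  (fun m i z => ltac:(case=> A B; split;
     [have := inv_S_dec m; lra | by rewrite S_INR in B; lra]))
  (fun m => ltac:(apply: (U_by_contra HU) => Hn; apply: no;
     exists (/ INR (S m)), (INR m); split; [exact: inv_S_pos |];
     apply: (U_mono HU) Hn => i Hi z Hz; apply: Rnot_lt_le => HM; apply: Hi; by exists z)).
have [M HM] : boundedC U (hev fs zs).
  apply: Hb => eps e0; have [m Hm] := inv_S_small e0.
  by apply: (U_mono HU) (Hz m) => i [A _]; lra.
have [m Hm] := INR_unbounded M.
apply: (U_const HU); apply: (U_mono2 HU) (Hz m) HM => i [_ A]; rewrite /hev; lra.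
Qed.

(** One choice of a point outside [Ds i] per index would give a point of the S-ball, hence of [B],
    outside the internal domain. Halving [r] leaves the standard margin that [Sball] demands. *)
Lemma internal_ball (Ds : nat -> Vec n -> Prop) (B : HV n -> Prop) (r : R) : 0 < r ->
  (forall z, Sball U a r z -> B z) -> (forall z, B z -> in_internal U Ds z) ->
  U (fun i => forall z, vnorm (vsub z (a i)) < r / 2 -> Ds i z).
Proof.
move=> r0 HB HD; apply: (U_by_contra HU) => Hn.
pose bad i z := vnorm (vsub z (a i)) < r / 2 /\ ~ Ds i z.
pose z i := epsilon (inhabits (a i)) (bad i).
have Hz : U (fun i => bad i (z i)).
  apply: (U_mono HU) Hn => i Hi; apply: epsilon_spec; apply: NNPP => no; apply: Hi => w Hw.
  by apply: NNPP => nD; apply: no; exists w.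
have : in_internal U Ds z.
  apply: HD; apply: HB; exists (r / 2); split; first lra.
  by apply: (U_mono HU) Hz => i [H _]; exact: Rlt_le.
by move=> HDz; apply: (U_const HU); apply: (U_mono2 HU) Hz HDz => i [_].
Qed.

Lemma in_shadow_Sball (r : R) (x0 x : Vec n) : approxV U a (cstV x0) ->
  (shadow U (Sball U a r) x <-> vnorm (vsub x x0) < r).
Proof.
move=> ax; split.
  case=> z [[s [sr Hs]] zx].
  apply: Rle_lt_trans sr; apply: le_epsilon => eps e0; apply: (U_const HU).
  apply: (U_mono2 HU) (zx (eps / 2) ltac:(lra)) (U_and HU Hs (ax (eps / 2) ltac:(lra))) => i A [B D].
  rewrite /cstV in A D.
  have T1 := vnorm_sub_triangle x (z i) x0; have T2 := vnorm_sub_triangle (z i) (a i) x0.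
  by rewrite (vnorm_sub_sym x (z i)) in T1; lra.
move=> Hx; exists (cstV x); split; last exact: approxV_refl.
exists ((vnorm (vsub x x0) + r) / 2); split; first lra.
apply: (U_mono HU) (ax ((r - vnorm (vsub x x0)) / 2) ltac:(lra)) => i; rewrite /cstV => A.
have T := vnorm_sub_triangle x x0 (a i).
by rewrite (vnorm_sub_sym x0 (a i)) in T; lra.
Qed.

(* If [f] omitted the value [w] on a small disc about [a] in the direction [v],
   the minimum modulus principle would contradict [w] being infinitely close to
   [f a], since [g] differs from [g x0] on a whole circle. *)
Lemma halo_surjective (g : Vec n -> C) (x0 v : Vec n) (r M d : R) (w : HC) :
  0 < r -> U (fun i => bhol (a i) r M (fs i)) -> approxV U a (cstV x0) ->
  (forall z x, vnorm (vsub x x0) < r -> approxV U z (cstV x) ->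
     approxC U (hev fs z) (cstC (g x))) ->
  0 < d -> (forall t, 0 < Cmod t < d -> g (vadd x0 (vscal t v)) <> g x0) ->
  approxC U w (hev fs a) ->
  exists z, approxV U z a /\ heqC U (hev fs z) w.
Proof.
move=> r0 Hhol ax Hg d0 Hd wa.
have v0 := vnorm_ge0 v.
have N0 : 0 < vnorm v + 1 by lra.
have wg : approxC U w (cstC (g x0)).
  by apply: (approxC_trans HU wa); apply: Hg => //; rewrite vnorm_sub_refl.
apply: (halo_saturation (P := fun i z => fs i z = w i)) => m.
have im := inv_S_pos m.
pose q := Rmin r (/ INR (S m)) / (vnorm v + 1).
have mq0 : 0 < Rmin r (/ INR (S m)) by exact: Rmin_pos.
have q0 : 0 < q by exact: Rdiv_lt_0_compat.
have qN : q * (vnorm v + 1) = Rmin r (/ INR (S m)) by rewrite /q; field; lra.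
(* Parameters of modulus below [q] keep the point within both [r] and [1 / (m + 1)] of [a i].
   [min_modulus] uses the disc of radius [2 * tau < q], and [tau < d] puts the circle where [g]
   differs from [g x0]. *)
pose tau := Rmin (d / 2) (q / 4).
have tau0 : 0 < tau by apply: Rmin_pos; lra.
have tau_d : tau <= d / 2 := Rmin_l _ _.
have tau_q : tau <= q / 4 := Rmin_r _ _.
have tq (t : R) : 0 <= t -> t < q -> t * vnorm v < Rmin r (/ INR (S m)).
  move=> t0 tq; rewrite -qN.
  apply: (Rle_lt_trans _ (t * (vnorm v + 1))); first by apply: Rmult_le_compat_l; lra.
  by apply: Rmult_lt_compat_r; lra.
(* Otherwise saturation gives [t] on the circle with [fs - w] infinitesimal; its standard part is
   still on the circle, and there [g] takes the value [g x0]. *)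
have circ : exists k, U (fun i => forall t, Cmod t = tau ->
    / INR (S k) <= Cmod (fs i (vadd (a i) (vscal t v)) - w i)).
  apply: NNPP => no.
  have [ts Ht] := @saturation U HU C (RtoC 0)
    (fun k i t => Cmod t = tau /\ Cmod (fs i (vadd (a i) (vscal t v)) - w i) < / INR (S k))
    (fun k i t => ltac:(case=> A B; split=> //; have := inv_S_dec k; lra))
    (fun k => ltac:(apply: (U_by_contra HU) => Hn; apply: no; exists k;
      apply: (U_mono HU) Hn => i Hi t Ht; apply: Rnot_lt_le => Hlt; apply: Hi; by exists t)).
  have [t Htt] : exists t, approxC U ts (cstC t).
    by apply: (standard_part HU); exists tau; apply: (U_mono HU) (Ht O) => i [-> _]; lra.
  have mt : Cmod t = tau.
    apply: Rle_antisym.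
      by apply: (approxC_le HU Htt); apply: (U_mono HU) (Ht O) => i [-> _]; lra.
    apply: le_epsilon => eps e0; apply: (U_const HU).
    apply: (U_mono2 HU) (Ht O) (Htt eps e0) => i [<- _]; rewrite /cstC => A.
    have {1}-> : ts i = (t + (ts i - t))%C by ring.
    by apply: Rle_trans (Cmod_triangle _ _) _; lra.
  apply: (Hd t); first by rewrite mt; lra.
  apply: (approxC_uniq HU (u := hev fs (fun i => vadd (a i) (vscal (ts i) v)))).
    apply: Hg.
      rewrite vsub_add vnorm_scal mt.
      by have := tq tau ltac:(lra) ltac:(lra); have := Rmin_l r (/ INR (S m)); lra.
    move=> eps e0.
    have e1 : 0 < eps / 2 / (vnorm v + 1) by apply: Rdiv_lt_0_compat; lra.
    apply: (U_mono2 HU) (ax (eps / 2) ltac:(lra)) (Htt _ e1) => i A B.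
    rewrite /cstV /cstC in A B *.
    have -> : vsub (vadd (a i) (vscal (ts i) v)) (vadd x0 (vscal t v)) =
      vadd (vsub (a i) x0) (vscal (ts i - t)%C v).
      by apply: functional_extensionality => k; rewrite /vsub /vadd /vscal; ring.
    apply: Rle_lt_trans (vnorm_triangle _ _) _; rewrite vnorm_scal.
    have : Cmod (ts i - t) * vnorm v <= eps / 2.
      have -> : eps / 2 = eps / 2 / (vnorm v + 1) * (vnorm v + 1) by field; lra.
      by apply: Rmult_le_compat; [exact: Cmod_ge_0 | | lra | lra].
    lra.
  apply: (approxC_trans HU (v := w)) => // eps e0; have [k Hk] := inv_S_small e0.
  by apply: (U_mono HU) (Ht k) => i [_ A]; rewrite /hev; lra.
have [k Hk] := circ; have eta0 := inv_S_pos k; set eta := / INR (S k) in Hk eta0.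
(* A value below [eta / 4] at the centre contradicts the bound [eta <= 2 * |f 0|] of
   [min_modulus]. *)
apply: (U_mono2 HU) (U_and HU Hhol Hk) (wa (eta / 4) ltac:(lra)) => i [Hb Hc] Hw.
apply: NNPP => no.
have [H1 H2] := bhol_line N0 (ltac:(lra) : vnorm v <= vnorm v + 1) Hb.
have rq : q <= r / (vnorm v + 1).
  by apply: Rmult_le_compat_r; [apply: Rlt_le; exact: Rinv_0_lt_compat | exact: Rmin_l].
have : eta <= 2 * Cmod (fs i (vadd (a i) (vscal 0%C v)) + - w i).
  apply: (@min_modulus (2 * tau) tau eta (fun t => fs i (vadd (a i) (vscal t v)) + - w i)%C
    (fun t => vdot (grad (fs i) (vadd (a i) (vscal t v))) v + 0)%C) => //; first lra.
  - by move=> t Ht; apply: cder_plus; [apply: H1; lra | exact: cder_const].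
  - move=> t Ht E; apply: no; exists (vadd (a i) (vscal t v)); split.
      rewrite vsub_add vnorm_scal.
      have := tq (Cmod t) (Cmod_ge_0 t) ltac:(lra); have := Rmin_r r (/ INR (S m)); lra.
    by apply: Csub_eq0.
rewrite vadd0; move: Hw; rewrite Cmod_sub_sym /hev /Cminus; lra.
Qed.

End Halo.

Theorem theorem2p2p1
  (U : (nat -> Prop) -> Prop) (HU : nonprincipal_ultrafilter U)
  (n : nat) (Ds : nat -> Vec n -> Prop) (fs : nat -> Vec n -> C)
  (B : HV n -> Prop) (a : HV n)
  (Hhol : internal_holomorphic U Ds fs)
  (HBresp : respects U B) (HBopen : Sopen U B)
  (HBD : forall z, B z -> in_internal U Ds z)
  (Ha : B a) (Habd : boundedV U a)
  (Hfbd : forall z, approxV U z a -> boundedC U (hev fs z)) :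
  exists (V : HV n -> Prop) (g : Vec n -> C),
    respects U V /\ Sopen U V /\ V a /\ (forall z, V z -> B z) /\
    (* (i) *)
    (forall z, V z -> S_continuous_at U fs z) /\
    (* (ii) *)
    holomorphic_on (shadow U V) g /\
    (forall (z : HV n) (x : Vec n), V z -> shadow U V x -> approxV U z (cstV x) ->
        approxC U (hev fs z) (cstC (g x))) /\
    (forall (alpha : 'I_n -> nat) (x : Vec n), shadow U V x ->
        S_continuous_at U (fun i => dalpha alpha (fs i)) (cstV x) /\
        approxC U (hev (fun i => dalpha alpha (fs i)) (cstV x))
                  (cstC (dalpha alpha g x))) /\
    (* (iii) *)
    ((exists x y, shadow U V x /\ shadow U V y /\ g x <> g y) ->
       (forall z, approxV U z a -> approxC U (hev fs z) (hev fs a)) /\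
       (forall w : HC, approxC U w (hev fs a) ->
          exists z, approxV U z a /\ heqC U (hev fs z) w)).
Proof.
have [x0 ax] := standard_partV HU Habd.
have [d1 [d10 Hd1]] := HBopen a Ha.
have HD := internal_ball HU d10 Hd1 HBD.
have [d2 [M [d20 HM]]] := bounded_on_halo HU Hfbd.
pose R1 := Rmin (d1 / 2) d2.
have R10 : 0 < R1 by apply: Rmin_pos; lra.
have R1a : R1 <= d1 / 2 := Rmin_l _ _.
have R1b : R1 <= d2 := Rmin_r _ _.
have Hba : U (fun i => bhol (a i) R1 M (fs i)).
  apply: (U_mono2 HU) (U_and HU HD HM) Hhol => i [A1 A2] [_ A3] z Hz.
  by split; [apply: A3; apply: A1; lra | apply: A2; lra].
(* Half of [R1] absorbs the infinitesimal shift from [a i] to the standard centre [x0]. Halving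
   again, to [rho], keeps the points of [V] within a standard radius less than [r] of [x0]. *)
pose r := R1 / 2.
have r0 : 0 < r by rewrite /r; lra.
have Hbx : U (fun i => bhol x0 r M (fs i)).
  apply: (U_mono2 HU) Hba (ax r r0) => i Hb A.
  apply: bhol_sub Hb; rewrite vnorm_sub_sym; rewrite /cstV /r in A *; lra.
have HF : ufam (U := U) fs x0 r.
  move=> r' Hr'; exists M; apply: (U_mono HU) Hbx => i Hb z Hz.
  by apply: Hb; lra.
pose g z := epsilon (inhabits (RtoC 0)) (fun y => approxC U (hev fs (cstV z)) (cstC y)).
have HG : ulim (U := U) fs g x0 r.
  move=> z Hz.
  apply: (epsilon_spec (inhabits (RtoC 0)) (fun y => approxC U (hev fs (cstV z)) (cstC y))).
  apply: (standard_part HU); exists M; apply: (U_mono HU) Hbx => i Hb.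
  by have [] := Hb _ Hz.
pose rho := r / 2.
have rr : 0 < rho < r by rewrite /rho; lra.
have sh x := in_shadow_Sball HU rho x ax.
have VS z : Sball U a rho z -> exists s, s < r /\ U (fun i => vnorm (vsub (z i) x0) <= s).
  case=> s [sr Hs]; exists (s + r / 4); split; first by rewrite /rho in sr; lra.
  apply: (U_mono2 HU) Hs (ax (r / 4) ltac:(lra)) => i A D.
  by apply: Rle_trans (vnorm_sub_triangle _ (a i) _) _; rewrite /cstV in D; lra.
have scont z : Sball U a rho z -> S_continuous_at U fs z.
  by move=> /VS [s [sr Hs]]; apply: (ufam_S_continuous HU HF sr Hs).
have near x z : vnorm (vsub x x0) < r -> approxV U z (cstV x) ->
    approxC U (hev fs z) (cstC (g x)).
  move=> Hx zx; apply: (approxC_trans HU (v := hev fs (cstV x))); last exact: HG.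
  have Hc : U (fun i => vnorm (vsub (cstV x i) x0) <= vnorm (vsub x x0)).
    by apply: (U_true HU) => i; rewrite /cstV; lra.
  exact: (ufam_S_continuous HU HF Hx Hc).
have Va : Sball U a rho a.
  by exists 0; split; [lra | apply: (U_true HU) => i; rewrite vnorm_sub_refl; lra].
exists (Sball U a rho), g.
split; [|split; [|split; [|split; [|split; [|split; [|split; [|split]]]]]]] => //.
- move=> z w zw [s [sr Hs]]; exists s; split=> //.
  by apply: (U_mono2 HU) zw Hs => i ->.
- move=> p [s [sr Hs]]; exists (rho - s); split; first lra.
  move=> q [t [tr Ht]]; exists (t + s); split; first lra.
  by apply: (U_mono2 HU) Hs Ht => i A D; have := vnorm_sub_triangle (q i) (p i) (a i); lra.
- move=> z [s [sr Hs]]; apply: Hd1; exists s; split=> //.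
  by rewrite /rho /r in sr; lra.
- split.
    move=> z /sh Hz; exists (rho - vnorm (vsub z x0)); split; first lra.
    by move=> w Hw; apply/sh; have := vnorm_sub_triangle w z x0; lra.
  move=> z /sh Hz; exists (grad g z).
  by have [] := ulim_derive HU HF HG (z := z) ltac:(lra).
- by move=> z x _ /sh Hx; apply: near; lra.
- move=> alpha x /sh Hx; have [DF DG] := ulim_dalpha HU alpha HF HG.
  split; last by apply: DG; lra.
  apply: (ufam_S_continuous HU DF (s := vnorm (vsub x x0))); first lra.
  by apply: (U_true HU) => i; rewrite /cstV; lra.
- move=> [x [y [/sh Hx [/sh Hy gxy]]]]; split; first exact: scont.
  (* Two distinct values of [g] cannot both equal [g x0]. *)
  have [y' [Hy' gy']] : exists y', vnorm (vsub y' x0) < rho /\ g y' <> g x0.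
    case: (classic (g x = g x0)) => E; last by exists x.
    by exists y; split=> // E'; apply: gxy; rewrite E E'.
  pose v := vsub y' x0.
  have gM z : vnorm (vsub z x0) < r -> Cmod (g z) <= M.
    move=> Hz; apply: (approxC_le HU (HG _ Hz)); apply: (U_mono HU) Hbx => i Hb.
    by have [] := Hb _ Hz.
  have gb : bhol x0 r M g.
    move=> z Hz; split; last exact: gM.
    by exists (grad g z); have [] := ulim_derive HU HF HG Hz.
  have [H1 H2] := bhol_line (N := rho) (h := v) ltac:(lra) ltac:(rewrite /v; lra) gb.
  (* The line through [x0] and [y'] is thus available for parameters of modulus less than 2, which
     include the parameter 1 of [y'], as [isolated_zero] requires. *)
  have E2 : r / rho = 2 by rewrite /rho; field; lra.
  rewrite E2 in H1 H2.
  have [d [d0 Hd]] : exists d, 0 < d /\ forall t, 0 < Cmod t < d ->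
      (g (vadd x0 (vscal t v)) + - g x0)%C <> 0%C.
    apply: (@isolated_zero U HU 2 (2 * M) (fun t => g (vadd x0 (vscal t v)) + - g x0)%C
      (fun t => vdot (grad g (vadd x0 (vscal t v))) v + 0)%C); first lra.
    + by move=> t Ht; apply: cder_plus; [exact: H1 | exact: cder_const].
    + move=> t Ht; apply: Rle_trans (Cmod_triangle _ _) _; rewrite Cmod_opp.
      by have := H2 t Ht; have := gM x0 ltac:(rewrite vnorm_sub_refl; lra); lra.
    + by rewrite vadd0; ring.
    + by rewrite vscal1 /v vadd_sub => /Csub_eq0.
  move=> w wa.
  apply: (@halo_surjective U HU n fs a g x0 v r M d w) => //.
  + by apply: (U_mono HU) Hba => i Hb z Hz; apply: Hb; rewrite /r in Hz; lra.
  + by move=> z x' Hx' zx; exact: near.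
  + move=> t Ht E; apply: (Hd t Ht); rewrite E; ring.
Qed.
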